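(* Let $p\geq 0$, $k\geq p+1$, and let $G$ be a balanced bipartite graph of order $2n$ with minimum degree $\delta(G)\geq k$. (i) If $k=p+2$, $n\geq 2k^2+3$, and $\rho(G)\geq \rho(N_{n,n}^{k-2,1})$, then $G$ is $2p$-Hamilton-biconnected unless $G= N_{n,n}^{k-2,1}$. (ii) If $k\neq p+2$, $n\geq (k+2)(k-p+1)$, and $\rho(G)\geq \rho(M_{n,n}^{n-k,k-p})$, then $G$ is $2p$-Hamilton-biconnected unless $G= M_{n,n}^{n-k,k-p}$.
   Context: $\rho(G)$ is the spectral radius (largest eigenvalue of the adjacency matrix) of $G$. A bipartite graph $G=(X,Y;E)$ is balanced if $|X|=|Y|$; it is Hamilton-biconnected if for every $u\in X$, $v\in Y$ there is a Hamiltonian path with ends $u,v$. A vertex set $W$ is balanced if $|W\cap X|=|W\cap Y|$; $G$ is $2p$-Hamilton-biconnected if for every balanced $W$ with $|W|=2p$, the subgraph induced by $V(G)\setminus W$ is Hamilton-biconnected. $M_{n,m}^{s,t}$: parts $X=X_1\cup X_2$, $Y=Y_1\cup Y_2$, $|X_1|=s$, $|X_2|=n-s$, $|Y_1|=m-t$, $|Y_2|=t$; edges are all pairs between $X_1$ and $Y_1$, between $X_2$ and $Y_1$, and between $X_2$ and $Y_2$. $N_{n,n}^{q,1}$: parts $X=X_1\cup X_2\cup X_3$, $Y=Y_1\cup Y_2\cup Y_3$, $|X_1|=|Y_1|=n-q-2$, $|X_2|=|Y_2|=q+1$, $|X_3|=|Y_3|=1$; edges are all pairs between $X_i$ and $Y_i$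 ($i=1,2,3$), between $X_1$ and $Y_2$, between $X_2$ and $Y_1\cup Y_3$, and between $X_3$ and $Y_2$. ''$G=H$'' means isomorphic. *)

(* Defs.v *)
From HB Require Import structures.
From mathcomp Require Import all_boot all_order all_algebra.
From mathcomp Require Import fingroup perm.
From mathcomp Require Import classical_sets reals.

Set Implicit Arguments.
Unset Strict Implicit.
Unset Printing Implicit Defensive.

Import Order.TTheory GRing.Theory Num.Theory.

(* A balanced bipartite graph G = (X, Y; E) of order 2n is encoded by its
   biadjacency relation  B : 'I_n -> 'I_n -> bool  ("x_i y_j is an edge").
   The vertex set is  'I_n + 'I_n : inl i is x_i in X, inr j is y_j in Y. *)

Definition bvert (n : nat) : finType := ('I_n + 'I_n)%type.

Definition biadj (n : nat) := 'I_n -> 'I_n -> bool.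

Definition gadj (n : nat) (B : biadj n) : rel (bvert n) :=
  fun u v => match u, v with
             | inl i, inr j => B i j
             | inr j, inl i => B i j
             | _, _ => false
             end.

Definition inX (n : nat) (v : bvert n) : bool := if v is inl _ then true else false.
Definition inY (n : nat) (v : bvert n) : bool := if v is inr _ then true else false.

Definition Xpart (n : nat) : {set bvert n} := [set v | inX v].
Definition Ypart (n : nat) : {set bvert n} := [set v | inY v].

Definition min_deg_ge (n : nat) (B : biadj n) (k : nat) : Prop :=
  forall v : bvert n, k <= #|[set w | gadj B v w]|.

Definition bimx (R : nzRingType) (n : nat) (B : biadj n) : 'M[R]_n :=
  \matrix_(i, j) ((B i j)%:R)%R.

Definition adjmx (R : nzRingType) (n : nat) (B : biadj n) : 'M[R]_(n + n) :=
  block_mx 0 (bimx R B) (bimx R B)^T 0.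

Definition spec_rad (R : realType) (n : nat) (B : biadj n) : R :=
  sup [set x : R | eigenvalue (adjmx R B) x].

Definition ham_path (n : nat) (B : biadj n) (S : {set bvert n})
    (u v : bvert n) : Prop :=
  exists s : seq (bvert n),
    [/\ uniq (u :: s), (forall x, (x \in u :: s) = (x \in S)),
        path (gadj B) u s & last u s = v].

Definition ham_biconnected (n : nat) (B : biadj n) (S : {set bvert n}) : Prop :=
  forall u v : bvert n, u \in S :&: Xpart n -> v \in S :&: Ypart n ->
    ham_path B S u v.

Definition ham_biconnected_2p (n : nat) (B : biadj n) (p : nat) : Prop :=
  forall W : {set bvert n},
    #|W :&: Xpart n| = #|W :&: Ypart n| -> #|W| = (2 * p)%N ->
    ham_biconnected B (~: W).

Definition giso (n : nat) (B B' : biadj n) : Prop :=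
  exists f : {perm bvert n}, forall u v, gadj B u v = gadj B' (f u) (f v).

(* M_{n,n}^{s,t}: X1 = {x_i | i < s}, X2 = rest, Y1 = {y_j | j < n - t},
   Y2 = rest; edges X1-Y1, X2-Y1, X2-Y2. *)
Definition Mgraph (n s t : nat) : biadj n :=
  fun i j => ((j : nat) < n - t) || (s <= i).

Definition Nclass (n q : nat) (i : 'I_n) : nat :=
  if (i : nat) < n - q - 2 then 1 else if (i : nat) < n - 1 then 2 else 3.

Definition Ngraph (n q : nat) : biadj n :=
  fun i j => ~~ ((@Nclass n q i == 1) && (@Nclass n q j == 3))
          && ~~ ((@Nclass n q i == 3) && (@Nclass n q j == 1)).

Arguments Mgraph : clear implicits.
Arguments Ngraph : clear implicits.
Arguments spec_rad : clear implicits.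

(* Main.v *)
Require Import Defs.
From mathcomp Require Import classical_sets boolp reals.
From mathcomp Require Import all_boot all_order all_algebra.
From mathcomp Require Import fingroup perm.
From mathcomp Require Import polyrcf.
From mathcomp Require Import zify ring lra.
Import Order.TTheory GRing.Theory Num.Theory.

Set Implicit Arguments.
Unset Strict Implicit.
Unset Printing Implicit Defensive.

(** Write [t = k - p] and delete [W], leaving [m = n - p] vertices on each side.
    As [rho(G)^2 <= e(G)], the hypothesis on [rho(G)] forces [G] to miss fewer
    than [t n] edges.  Fix the prescribed ends [u] and [v].  Reversing a segment of a
    Hamiltonian path shows that a missing edge [xy] may be added whenever
    [d(x) + d(y) >= m + 2], and already when [d(x) + d(y) = m + 1] unless
    [x ~ v] and [u ~ y].  In a graph closed under this rule, a
    nonadjacent pair of maximal degree sum together with the few missing edges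
    leaves only these possibilities: a Hamiltonian [u]-[v] path exists, or one side has
    [t] vertices whose degree in [G] is at most [k], or [t = 2] and [G] is a
    subgraph of [N].

    Let [(a, b)] be the absolute values of an eigenvector for [lambda = rho(G)^2],
    suppose that [S] is a set of [t] rows of degree [k], and put
    [Sg = sum_j b_j] and [Q = sum_(i in S) sum_(j ~ i) b_j].  Then
    [lambda Sg <= n (n - t) Sg + k Q] and [lambda Q <= t k (n - t) Sg + t k Q],
    so [lambda] is at most the larger root of
    [(z - n (n - t)) (z - t k) = t k^2 (n - t)], which is [rho(M)^2], with equality
    only if [G = M].  For [t = 2] that root is below [(n - 1)^2 < rho(N)^2]. *)

(** * Hamiltonian paths with prescribed ends *)

Section PathReversal.
Variables (T : eqType) (e : rel T).
Hypothesis e_sym : symmetric e.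

Lemma sorted_rev_sym (s : seq T) : sorted e (rev s) = sorted e s.
Proof. by rewrite rev_sorted; apply: eq_sorted => x y; rewrite e_sym. Qed.

(** Reversing the positions [lo.+1] to [hi] trades the steps at [lo] and [hi], which may fail to be
    edges, for the two given edges. The segment is interior, so both ends of [P] stay in place. *)
Lemma two_opt (z0 : T) (P : seq T) (lo hi : nat) :
  lo < hi -> hi.+1 < size P ->
  (forall i, i.+1 < size P -> i != lo -> i != hi ->
     e (nth z0 P i) (nth z0 P i.+1)) ->
  e (nth z0 P lo) (nth z0 P hi) -> e (nth z0 P lo.+1) (nth z0 P hi.+1) ->
  exists Q, [/\ perm_eq Q P, sorted e Q, nth z0 Q 0 = nth z0 P 0
              & last z0 Q = last z0 P].
Proof.
move=> lohi hiP eP e1 e2.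
pose A := take lo.+1 P; pose B := drop lo.+1 (take hi.+1 P).
pose C := drop hi.+1 P.
have szA : size A = lo.+1 by rewrite /A size_takel //; lia.
have szB : size B = hi - lo by rewrite /B size_drop size_takel //; lia.
have szC : size C = size P - hi.+1 by rewrite /C size_drop.
have nA i : i <= lo -> nth z0 A i = nth z0 P i by move=> h; rewrite nth_take.
have nB i : i < hi - lo -> nth z0 B i = nth z0 P (lo.+1 + i).
  by move=> h; rewrite nth_drop nth_take //; lia.
have nC i : nth z0 C i = nth z0 P (hi.+1 + i) by rewrite nth_drop.
have eqABC : P = A ++ B ++ C.
  by rewrite catA /A /B /C -{1}(cat_take_drop hi.+1 P) -{1}(cat_take_drop lo.+1 (take hi.+1
      P)) take_takel //; lia.
exists (A ++ rev B ++ C); split.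
- by rewrite [X in perm_eq _ X]eqABC perm_cat2l perm_cat2r perm_rev.
- apply/(sortedP z0) => i; rewrite !size_cat size_rev szA szB szC => hi'.
  rewrite !nth_cat !size_rev szA szB.
  case: (ltnP i.+1 lo.+1) => h1.
    rewrite (ltn_trans _ h1) // !nA; [apply: eP => //; lia|lia|lia].
  case: (ltnP i lo.+1) => h2.
    have -> : i = lo by lia.
    rewrite subnn ifT; last by lia.
    rewrite nth_rev szB; last by lia.
    rewrite nA // nB; last by lia.
    by have -> : lo.+1 + (hi - lo - 1) = hi by lia.
  case: (ltnP (i.+1 - lo.+1) (hi - lo)) => h3.
    rewrite ifT; last by lia.
    rewrite !nth_rev ?szB; [|lia|lia].
    rewrite !nB; [|lia|lia].
    rewrite e_sym.
    have -> : lo.+1 + (hi - lo - (i - lo.+1).+1) = (lo.+1 + (hi - lo - (i.+1 - lo.+1).+1)).+1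
        by lia.
    by apply: eP; lia.
  case: (ltnP (i - lo.+1) (hi - lo)) => h4.
    have -> : i = hi by lia.
    rewrite nth_rev ?szB; last by lia.
    rewrite nB; last by lia.
    have -> : lo.+1 + (hi - lo - (hi - lo.+1).+1) = lo.+1 by lia.
    have -> : hi.+1 - lo.+1 - (hi - lo) = 0 by lia.
    by rewrite nC addn0.
  rewrite !nC.
  have -> : hi.+1 + (i - lo.+1 - (hi - lo)) = i by lia.
  have -> : hi.+1 + (i.+1 - lo.+1 - (hi - lo)) = i.+1 by lia.
  by apply: eP; lia.
- by rewrite nth_cat szA /= nA.
- rewrite [X in _ = last _ X]eqABC !last_cat.
  by case: (C) szC => [|c C'] //=; lia.
Qed.

End PathReversal.

(** Pigeonhole on the positions that have a successor: there [pa] and [par] lose their last value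
    and [pb], read one place later, loses its first, whence the correction terms. In use, [pa] and
    [pb] are adjacency to the two ends of a missing edge and [par] is one side of the graph. *)
Lemma count_overlap (T : eqType) (z0 : T) (P : seq T) (pa pb par : pred T) :
  0 < size P ->
  (forall i, i.+1 < size P -> pa (nth z0 P i) -> par (nth z0 P i)) ->
  (forall i, i.+1 < size P -> pb (nth z0 P i.+1) -> par (nth z0 P i)) ->
  count par P + (pa (last z0 P)) + pb (nth z0 P 0) <
    count pa P + count pb P + par (last z0 P) ->
  exists i, [/\ i.+1 < size P, pa (nth z0 P i) & pb (nth z0 P i.+1)].
Proof.
case: P => [|p0 P] //= _ hpa hpb hlt.
have cnt (f : pred T) : count f (p0 :: P) = count (fun i => f (nth z0 (p0 :: P) i)) (iota 0
    (size P)) + f (last p0 P).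
  rewrite -{1}[p0 :: P](mkseq_nth z0) /mkseq count_map.
  rewrite (_ : iota 0 (size (p0 :: P)) = iota 0 (size P + 1)); last by rewrite addn1.
  by rewrite iotaD count_cat /= add0n addn0 -[last p0 P]/(last z0 (p0 :: P)) -nth_last.
have cnt2 (f : pred T) : count f (p0 :: P) = f p0 + count (fun i => f (nth z0 (p0 :: P)
    i.+1)) (iota 0 (size P)).
  rewrite /= -{1}[P](mkseq_nth z0) /mkseq count_map; congr (_ + _).
set I := iota 0 (size P) in cnt cnt2.
pose qa i := pa (nth z0 (p0 :: P) i); pose qb i := pb (nth z0 (p0 :: P) i.+1).
pose qp i := par (nth z0 (p0 :: P) i).
have h1 := cnt pa; have h2 := cnt2 pb; have h3 := cnt par.
rewrite -/qa -/qb -/qp /= in h1 h2 h3.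
have hui := count_predUI qa qb I.
have hsub : count (predU qa qb) I <= count qp I.
  rewrite (@eq_in_count _ _ (predI (predU qa qb) qp)).
    by apply: sub_count => i /andP[].
  move=> i; rewrite mem_iota add0n => /andP[_ hi] /=; apply/esym/andb_idr.
  by case/orP => h; [apply: (hpa i) | apply: (hpb i)].
have : has (predI qa qb) I by rewrite has_count; lia.
case/hasP => i; rewrite mem_iota add0n => /andP[_ hi] /andP[ha hb].
by exists i; split.
Qed.

(** * Bipartite graphs and the rule for adding a missing edge *)

Definition transp (X Y : finType) (E : X -> Y -> bool) : Y -> X -> bool := fun y x => E x y.

Definition deg (X Y : finType) (E : X -> Y -> bool) (x : X) : nat := #|[set y | E x y]|.

Definition codeg (X Y : finType) (E : X -> Y -> bool) (x : X) : nat :=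
  #|[set y | ~~ E x y]|.

Definition missing (X Y : finType) (E : X -> Y -> bool) : nat := \sum_x codeg E x.

Definition bip_adj (X Y : finType) (E : X -> Y -> bool) : rel (X + Y) :=
  fun a b => match a, b with
             | inl x, inr y => E x y
             | inr y, inl x => E x y
             | _, _ => false
             end.

Definition hpath (X Y : finType) (E : X -> Y -> bool) (u : X) (v : Y) : Prop :=
  exists s : seq (X + Y),
    [/\ uniq (inl u :: s), (forall z, z \in inl u :: s),
        path (bip_adj E) (inl u) s & last (inl u) s = inr v].

Definition add_edge (X Y : finType) (E : X -> Y -> bool) (x : X) (y : Y) : X -> Y -> bool :=
  fun x' y' => E x' y' || ((x' == x) && (y' == y)).

Section Bipartite.
Variables (X Y : finType).
Implicit Types (E : X -> Y -> bool).

Lemma bip_adj_sym E : symmetric (bip_adj E).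
Proof. by case=> a; case. Qed.

Lemma deg_codeg E x : deg E x + codeg E x = #|Y|.
Proof.
rewrite -(cardsC [set y | E x y]); congr (_ + #|pred_of_set _|).
by apply/setP => y; rewrite !inE.
Qed.

Lemma count_all (T : finType) (P : seq T) (f : pred T) :
  uniq P -> (forall z, z \in P) -> count f P = #|f|.
Proof.
move=> uP mP; rewrite cardE -size_filter; apply/perm_size/uniq_perm.
- exact: filter_uniq.
- exact: enum_uniq.
by move=> z; rewrite mem_filter mem_enum mP andbT.
Qed.

Lemma card_adj_inl E x : #|bip_adj E (inl x)| = deg E x.
Proof.
rewrite /deg -(card_imset _ (@inr_inj X Y)).
apply: eq_card => -[x'|y]; rewrite ?inE /in_mem /=.
  by apply/esym/negbTE/imsetP => -[].
apply/idP/imsetP => [h|[y' ]]; first by exists y; rewrite ?inE.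
by rewrite inE => h [->].
Qed.

Lemma card_adj_inr E y : #|bip_adj E (inr y)| = deg (transp E) y.
Proof.
rewrite /deg -(card_imset _ (@inl_inj X Y)).
apply: eq_card => -[x|y']; rewrite ?inE /in_mem /=.
  apply/idP/imsetP => [h|[x' ]]; first by exists x; rewrite ?inE.
  by rewrite inE => h [->].
by apply/esym/negbTE/imsetP => -[].
Qed.

Definition is_left (z : X + Y) : bool := if z is inl _ then true else false.

Lemma card_is_left : #|is_left| = #|X|.
Proof.
rewrite -(cardsT X) -(card_imset _ (@inl_inj X Y)).
apply: eq_card => -[x|y]; rewrite ?inE /in_mem /=.
  by apply/esym/imsetP; exists x; rewrite ?inE.
by apply/esym/negbTE/imsetP => -[].
Qed.

Lemma card_is_right : #|predC is_left| = #|Y|.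
Proof.
have := cardC is_left; rewrite card_is_left card_sum => h.
exact: (@addnI #|X|).
Qed.

Lemma bip_adj_side E a b : bip_adj E a b -> is_left a = ~~ is_left b.
Proof. by case: a => a; case: b => b. Qed.

(** If the path uses the new edge at step [i0], [count_overlap] yields a step [i] with [w i ~ w i0]
    and [w i.+1 ~ w i0.+1], and [two_opt] exchanges the two steps. A neighbour [v] of [w i0] has no
    successor and a neighbour [u] of [w i0.+1] no predecessor, hence the stronger degree condition
    when both [xv] and [uy] are edges. *)
Lemma hpath_del E (u : X) (v : Y) (x : X) (y : Y) (m : nat) :
  #|X| = m -> #|Y| = m -> ~~ E x y -> m < deg E x + deg (transp E) y ->
  (E x v -> E u y -> m.+1 < deg E x + deg (transp E) y) ->
  hpath (add_edge E x y) u v -> hpath E u v.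
Proof.
move=> cX cY nxy d1 d2 [s [us ms ps ls]].
set e := bip_adj E.
pose P := inl u :: s.
have [pe|npe] := boolP (path e (inl u) s); first by exists s.
pose w i := nth (inl u) P i.
have wedge i : i.+1 < size P -> e (w i) (w i.+1) \/
   ((w i = inl x /\ w i.+1 = inr y) \/ (w i = inr y /\ w i.+1 = inl x)).
  move=> hi.
  have /(sortedP (inl u))/(_ i hi) : sorted (bip_adj (add_edge E x y)) P by [].
  rewrite -!/(w _); case: (w i) => a; case: (w i.+1) => b //=; rewrite /add_edge.
    case/orP => [h|/andP[/eqP-> /eqP->]]; [by left|right; by left].
  by case/orP => [h|/andP[/eqP-> /eqP->]]; [left|right; right].
have winj i j : i < size P -> j < size P -> w i = w j -> i = j.
  by move=> hi hj /eqP; rewrite nth_uniq // => /eqP.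
have [i0 i0P bad] : exists2 i0, i0.+1 < size P & ~~ e (w i0) (w i0.+1).
  have [/allP h|] := boolP (all (fun i => e (w i) (w i.+1)) (iota 0 (size s))).
    case/negP: npe; rewrite -[path _ _ _]/(sorted e P).
    by apply/(sortedP (inl u)) => i hi; apply: h; rewrite mem_iota.
  by case/allPn => i; rewrite mem_iota => /andP[_ hi] hb; exists i.
have {bad} ends : (w i0 = inl x /\ w i0.+1 = inr y) \/ (w i0 = inr y /\ w i0.+1 = inl x).
  by case: (wedge i0 i0P) => // h; rewrite h in bad.
have good i : i.+1 < size P -> i != i0 -> e (w i) (w i.+1).
  move=> hi hne; case: (wedge i hi) => // hbad; exfalso.
  (* A second use of the edge [xy] would repeat a vertex of the path. *)
  have : (w i = w i0) \/ (w i = w i0.+1 /\ w i.+1 = w i0).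
    by case: hbad => -[-> ->]; case: ends => -[-> ->]; auto.
  case=> [|[]].
    by move=> /winj h; rewrite h ?eqxx // in hne; apply: ltnW.
  by move=> /winj h1 /winj h2; have := h1 (ltnW hi) i0P; have := h2 hi (ltnW i0P); lia.
have [i [hi ea eb]] : exists i, [/\ i.+1 < size P, e (w i0) (w i) & e (w i0.+1) (w i.+1)].
  apply: (@count_overlap _ (inl u) P (e (w i0)) (e (w i0.+1))
           (fun z => is_left z != is_left (w i0))) => //.
  - by move=> i hi /bip_adj_side ->; rewrite /w; case: (is_left _).
  - move=> i hi /bip_adj_side hb.
    have hopp : is_left (w i0) = ~~ is_left (w i0.+1) by case: ends => -[-> ->].
    have [ii|ni] := eqVneq i i0; first by move: hb; rewrite ii -/(w _); case: is_left.
    have /bip_adj_side := good i hi ni.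
    by rewrite -/(w i) => ->; rewrite hopp hb -/(w i.+1); case: (is_left _).
  - have lP : last (inl u) P = inr v by [].
    rewrite lP !count_all //=.
    have cl : #|(fun z : X + Y => is_left z != true)| = m.
      by rewrite -cY -card_is_right; apply: eq_card => z; rewrite ?inE /in_mem /=; case: is_left.
    have cr : #|(fun z : X + Y => is_left z != false)| = m.
      by rewrite -cX -card_is_left; apply: eq_card => z; rewrite /in_mem /=; case: is_left.
    (* Traversed from [x] to [y], the step makes [xv] and [uy] matter, and the last vertex [v] lies
       on the counted side. Traversed from [y] to [x], all corrections vanish. *)
    case: ends => -[-> ->] /=; rewrite card_adj_inl card_adj_inr ?cl ?cr.
      by move: d1 d2; case: (E x v); case: (E u y) => //= d1 d2; try (have := d2 isT isT); lia.
    lia.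
have es : symmetric e by exact: bip_adj_sym.
have ne : i != i0 by apply/eqP => h; move: ea; rewrite h => /bip_adj_side; case: is_left.
have sP j k : j < k -> k.+1 < size P -> (j = i0 /\ k = i) \/ (j = i /\ k = i0) ->
    exists Q, [/\ perm_eq Q P, sorted e Q, nth (inl u) Q 0 = nth (inl u) P 0
              & last (inl u) Q = last (inl u) P].
  move=> jk hk ji; apply: (@two_opt _ e (bip_adj_sym E) (inl u) P j k) => //.
  - by move=> l hl h1 h2; apply: good => //; apply/eqP => h; case: ji => -[];
      move: h1 h2 h => /eqP ? /eqP ?; lia.
  - by case: ji => -[-> ->] //; rewrite es.
  - by case: ji => -[-> ->] //; rewrite es.
have [Q [pQ sQ hQ lQ]] : exists Q, [/\ perm_eq Q P, sorted e Q, nth (inl u) Q 0 = nth (inl u) P 0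
              & last (inl u) Q = last (inl u) P].
  by case: (ltngtP i i0) ne => // h _; [apply: (sP i i0) | apply: (sP i0 i)]; auto.
case: Q pQ sQ hQ lQ => [|q Q] pQ sQ /= hQ lQ; first by move/perm_size: pQ.
subst q; exists Q; split => //.
- by rewrite (perm_uniq pQ).
- by move=> z; rewrite (perm_mem pQ).
- by rewrite lQ.
Qed.
End Bipartite.

(** Reading the path backwards exchanges its ends, so later arguments may choose the side on which
    they work. *)
Lemma hpath_transp (X Y : finType) (E : X -> Y -> bool) u v :
  hpath (transp E) v u -> hpath E u v.
Proof.
move=> [s [us ms ps ls]].
pose sw (z : Y + X) : X + Y := match z with inl y => inr y | inr x => inl x end.
have swI : injective sw by case=> a; case=> b //= [->].
have eQ : inl u :: map sw (rev (belast (inl v) s)) = map sw (rev (inl v :: s)).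
  by rewrite [in RHS]lastI rev_rcons ls.
exists (map sw (rev (belast (inl v) s))); rewrite eQ; split.
- by rewrite map_inj_uniq // rev_uniq.
- move=> z; pose z' : Y + X := match z with inl x => inr x | inr y => inl y end.
  have -> : z = sw z' by case: z @z'.
  by rewrite (mem_map swI) mem_rev.
- rewrite -[path _ _ _]/(sorted (bip_adj E) (inl u :: map sw (rev (belast (inl v) s)))) eQ.
  rewrite sorted_map (@eq_sorted _ _ (bip_adj (transp E))); last by case=> a; case.
  by rewrite sorted_rev_sym //; apply: bip_adj_sym.
- rewrite -[last _ _]/(last (inl u) (inl u :: map sw (rev (belast (inl v) s)))) eQ.
  by rewrite rev_cons map_rcons last_rcons.
Qed.

(** * Hamiltonian paths as alternating lists *)

Section ZigZag.
Variables (X Y : finType) (E : X -> Y -> bool).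

Fixpoint zig (xs : seq X) (ys : seq Y) : seq (X + Y) :=
  match xs, ys with
  | x :: xs', y :: ys' => inl x :: inr y :: zig xs' ys'
  | _, _ => [::]
  end.

Lemma zig_cat xs1 ys1 xs2 ys2 : size xs1 = size ys1 ->
  zig (xs1 ++ xs2) (ys1 ++ ys2) = zig xs1 ys1 ++ zig xs2 ys2.
Proof.
by elim: xs1 ys1 => [|x xs IH] [|y ys] //= [hs]; rewrite IH.
Qed.

Lemma zig_perm xs ys : size xs = size ys ->
  perm_eq (zig xs ys) (map inl xs ++ map inr ys).
Proof.
elim: xs ys => [|x xs IH] [|y ys] //= [hs].
by rewrite perm_cons perm_sym perm_catC /= perm_cons perm_sym perm_sym perm_catC perm_sym;
    apply: IH.
Qed.

(* [z] stands for the vertex preceding the zigzag. *)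
Lemma zig_path z xs ys :
  (forall x, ohead xs = Some x -> bip_adj E z (inl x)) ->
  (forall x y, x \in xs -> y \in ys -> E x y) ->
  path (bip_adj E) z (zig xs ys).
Proof.
elim: xs ys z => [|x xs IH] [|y ys] z //= h1 h2.
rewrite h1 // h2 ?mem_head //=; apply: IH.
  by case: xs {h1} h2 => [|x' xs] //= h2 _ [<-]; apply: h2; rewrite !inE eqxx ?orbT.
by move=> x' y' hx hy; apply: h2; rewrite inE ?hx ?hy orbT.
Qed.

Lemma last_zig z xs ys c : size xs = (size ys).+1 -> last z (zig xs (rcons ys c)) = inr c.
Proof.
elim: xs ys z => [|x xs IH] [|y ys] z //= [hs]; last exact: IH.
by case: xs hs {IH}.
Qed.

Lemma hpath_zig (u : X) (v : Y) xs ys : size xs = size ys ->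
  uniq (u :: xs) -> uniq (rcons ys v) -> (forall x, x \in u :: xs) ->
  (forall y, y \in rcons ys v) ->
  sorted (bip_adj E) (zig (u :: xs) (rcons ys v)) -> hpath E u v.
Proof.
move=> hs ux uy mx my sz.
have hs' : size (u :: xs) = size (rcons ys v) by rewrite /= size_rcons hs.
have pz := zig_perm hs'.
have lz := @last_zig (inl u) (u :: xs) ys v (congr1 succn hs).
have [s es] : exists s, zig (u :: xs) (rcons ys v) = inl u :: s.
  by case: (ys) => [|y ys'] /=; [exists [:: inr v & zig xs [::]] | exists (inr y :: zig xs
      (rcons ys' v))].
rewrite es in pz lz sz; exists s; split => //.
  rewrite (perm_uniq pz) cat_uniq !map_inj_uniq ?ux ?uy ?andbT //=; try by move=> a b [].
  by apply/hasPn => z /mapP[y _ ->]; apply/negP => /mapP[].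
move=> z; rewrite (perm_mem pz) mem_cat; case: z => [x|y].
  by rewrite map_f.
by rewrite (map_f inr) ?orbT.
Qed.

(** The path runs from [u] to [c] through the complete block on [u :: xs1] and [c :: ys1], crosses
    the edge [cx], and runs through the complete block on [x :: xs2] and [v :: ys2] to [v]. *)
Lemma hpath_blocks2 (u x : X) (c v : Y) xs1 ys1 xs2 ys2 :
  size xs1 = size ys1 -> size xs2 = size ys2 ->
  uniq (u :: xs1 ++ x :: xs2) -> uniq (ys1 ++ c :: rcons ys2 v) ->
  (forall z, z \in u :: xs1 ++ x :: xs2) -> (forall z, z \in ys1 ++ c :: rcons ys2 v) ->
  (forall a b, a \in u :: xs1 -> b \in c :: ys1 -> E a b) ->
  E x c -> (forall a b, a \in x :: xs2 -> b \in v :: ys2 -> E a b) -> hpath E u v.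
Proof.
move=> h1 h2 ux uy mx my e1 exc e2.
have ey : ys1 ++ c :: rcons ys2 v = rcons (ys1 ++ c :: ys2) v by rewrite rcons_cat.
rewrite ey in uy my.
apply: (@hpath_zig u v (xs1 ++ x :: xs2) (ys1 ++ c :: ys2)) => //.
  by rewrite !size_cat /= h1 h2.
rewrite -ey -(cat_rcons c) -cat_cons zig_cat; last by rewrite size_rcons /= h1.
(* [inr c] is prepended, using the edge [uc], because [zig_path] speaks of a preceding vertex;
   [path_sorted] drops it at the end. *)
have : path (bip_adj E) (inr c) (zig (u :: xs1) (rcons ys1 c) ++ zig (x :: xs2) (rcons ys2 v)).
  rewrite cat_path zig_path => [|a [<-]|a b ha]; last first.
  - by rewrite mem_rcons; apply: e1.
  - by rewrite /= e1 ?mem_head.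
  rewrite last_zig /= ?h1 //.
  rewrite -[path _ _ _]/(path (bip_adj E) (inr c) (zig (x :: xs2) (rcons ys2 v))).
  by apply: zig_path => [a [<-]|a b ha] //; rewrite mem_rcons; apply: e2.
exact: path_sorted.
Qed.

End ZigZag.

(** * Graphs closed under the edge-adding rule *)

Lemma uniq_full (T : finType) (s : seq T) :
  (forall z, z \in s) -> size s <= #|T| -> uniq s.
Proof.
move=> ms hs; apply: (@leq_size_uniq _ (enum T)); first exact: enum_uniq.
  by move=> z _.
by rewrite -cardE.
Qed.

(* The fixed point condition of the Bondy-Chvatal closure relative to the
   prescribed end vertices u and v. *)
Definition ore_closed (X Y : finType) (m : nat) (E : X -> Y -> bool) (u : X) (v : Y) : Prop :=
  forall x y, ~~ E x y -> deg E x + deg (transp E) y <= m.+1 /\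
    (deg E x + deg (transp E) y = m.+1 -> E x v /\ E u y).

Lemma ore_closed_transp (X Y : finType) m (E : X -> Y -> bool) u v :
  ore_closed m E u v -> ore_closed m (transp E) v u.
Proof.
move=> h y x nxy; have [h1 h2] := h x y nxy.
split; rewrite addnC //.
by move=> /h2[].
Qed.

Section Counting.
Variables (X Y : finType) (m : nat) (E : X -> Y -> bool).
Hypotheses (cX : #|X| = m) (cY : #|Y| = m).

Lemma missing_split (S : {set X}) (a : nat) :
  (forall s, s \in S -> deg E s <= a) ->
  #|S| * (m - a) + \sum_(x in ~: S) codeg E x <= missing E.
Proof.
move=> hS; rewrite /missing [X in _ <= X](bigID (mem S)) /=.
have -> : \sum_(x in ~: S) codeg E x = \sum_(x | x \notin S) codeg E x.
  by apply: eq_bigl => x; rewrite inE.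
rewrite leq_add2r -sum_nat_const; apply: leq_sum => s sS.
by have := deg_codeg E s; have := hS s sS; rewrite cY; lia.
Qed.

(** For a missing pair [xy] off [S] and [T], closedness gives [codeg x + codeg y >= m - 1]. Row [x]
    and column [y] meet [T] and [S] in at most [#|T| + #|S|] places; each missing pair off [S] and
    [T] is counted at most once more, except [xy], counted twice. Hence the slack 2. *)
Lemma complete_off (u : X) (v : Y) (S : {set X}) (T : {set Y}) :
  ore_closed m E u v ->
  #|S| + #|T| + \sum_(x in ~: S) #|[set y in ~: T | ~~ E x y]| + 2 < m ->
  forall x y, x \notin S -> y \notin T -> E x y.
Proof.
move=> hO hm x y xS yT; apply: contraT => nxy.
have [hd _] := hO x y nxy.
have h1 := deg_codeg E x; have h2 := deg_codeg (transp E) y.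
rewrite cX in h2; rewrite cY in h1.
have hx : codeg E x <= #|T| + #|[set y in ~: T | ~~ E x y]|.
  rewrite /codeg -(cardsID T [set y | ~~ E x y]) leq_add //; apply: subset_leq_card.
    by apply/subsetP => z; rewrite !inE => /andP[].
  by apply/subsetP => z; rewrite !inE.
have hy : codeg (transp E) y <= #|S| + (1 + \sum_(x' in ~: S :\ x) #|[set y in ~: T | ~~ E x'
    y]|).
  rewrite /codeg -(cardsID S [set x | ~~ transp E y x]) leq_add //.
    by apply: subset_leq_card; apply/subsetP => z; rewrite !inE => /andP[].
  have xin : x \in [set x | ~~ transp E y x] :\: S by rewrite !inE xS.
  rewrite (cardsD1 x) xin leq_add2l -sum1_card.
  rewrite [X in _ <= X](bigID (fun x' => ~~ E x' y)) /= -[X in X <= _]addn0 leq_add //.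
  rewrite (eq_bigl (fun x' => (x' \in ~: S :\ x) && ~~ E x' y)); last first.
    by move=> z; rewrite !inE /transp; case: (z == x); case: (z \in S); case: (E z y).
  apply: leq_sum => z /andP[_ hz].
  by rewrite card_gt0; apply/set0Pn; exists y; rewrite !inE yT.
have hsum : \sum_(x in ~: S) #|[set y in ~: T | ~~ E x y]| =
   #|[set y in ~: T | ~~ E x y]| + \sum_(x' in ~: S :\ x) #|[set y in ~: T | ~~ E x' y]|.
  rewrite (bigD1 x) /=; last by rewrite inE.
  by congr (_ + _); apply: eq_bigl => z; rewrite !inE andbC.
lia.
Qed.

Lemma complete_offX (u : X) (v : Y) (S : {set X}) :
  ore_closed m E u v ->
  #|S| + \sum_(x in ~: S) codeg E x + 2 < m ->
  forall x y, x \notin S -> E x y.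
Proof.
move=> hO hm x y xS; apply: (@complete_off u v S set0 hO) => //; last by rewrite inE.
rewrite cards0 addn0 (eq_bigr (codeg E)) // => z _.
by apply: eq_card => w; rewrite !inE.
Qed.

(** The path uses the rows off [S] with the columns outside [N(x)], enters [x] through a column [c]
    of [N(x)], and finishes with [S] and the rest of [N(x)]. Closedness puts all neighbours of [S]
    into [N(x)], joins [v] to all of [S], and leaves at most one column of [N(x)] not joined to all
    of [S]. *)
Lemma hpath_low (u : X) (v : Y) (S : {set X}) (x : X) :
  ore_closed m E u v -> x \in S -> deg E x = #|S|.+1 ->
  (forall s, s \in S -> #|S| <= deg E s) -> u \notin S ->
  (forall a b, a \notin S -> E a b) -> hpath E u v.
Proof.
move=> hO xS dx dS uS full; set r := #|S| in dx dS.
have r0 : 0 < r by rewrite card_gt0; apply/set0Pn; exists x.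
have cCS : #|~: S| + r = m by rewrite -cX -(cardsC S) addnC.
have dY b : m <= deg (transp E) b + r.
  rewrite -cCS leq_add2r; apply: subset_leq_card; apply/subsetP => a.
  by rewrite !inE; apply: full.
have dY1 b s : s \in S -> E s b -> m < deg (transp E) b + r.
  move=> sS sb; rewrite -cCS ltn_add2r.
  have -> : #|~: S|.+1 = #|s |: ~: S| by rewrite cardsU1 inE sS.
  apply: subset_leq_card; apply/subsetP => a; rewrite !inE => /orP[/eqP-> //|].
  exact: full.
have dY2 b s s' : s \in S -> s' \in S -> s != s' -> E s b -> E s' b ->
    m.+1 < deg (transp E) b + r.
  move=> sS sS' ns sb sb'; rewrite -cCS -addSn ltn_add2r.
  have -> : #|~: S|.+2 = #|s |: (s' |: ~: S)| by rewrite !cardsU1 !inE sS sS' (negbTE ns).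
  apply: subset_leq_card; apply/subsetP => a; rewrite !inE => /orP[/eqP-> //|/orP[/eqP->//|]].
  exact: full.
(* A neighbour in [S] raises the degree of [b] to [m - r + 1], and [deg E x = r + 1] brings the sum
   above [m + 1]. *)
have hN s b : s \in S -> E s b -> E x b.
  move=> sS sb; apply: contraT => nxb; have [h _] := hO _ _ nxb.
  by have := dY1 b s sS sb; lia.
have xv : E x v.
  apply: contraT => nxv; have [h1 h2] := hO _ _ nxv.
  case: h2 => [|h _]; [by have := dY v; lia|by rewrite h in nxv].
have sv s : s \in S -> E s v.
  move=> sS; apply: contraT => nsv; have [h1 h2] := hO _ _ nsv.
  case: h2 => [|h _]; last by rewrite h in nsv.
  by have := dY1 v x xS xv; have := dS s sS; lia.
pose N := [set b | E x b].
have cN : #|N| = r.+1 by rewrite -dx.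
(* The columns of [N] missed by some row of [S]; by degree sums such a column meets [S] only in
   [x]. *)
pose C := [set b in N | [exists s in S, ~~ E s b]].
have hC b s : b \in C -> s \in S -> E s b -> s = x.
  rewrite !inE => /andP[xb /existsP[s0 /andP[s0S ns0]]] sS sb.
  apply/eqP; apply: contraT => nsx; have [h1 _] := hO _ _ ns0.
  by have := dY2 b s x sS xS nsx sb xb; have := dS s0 s0S; lia.
(* A row of [S] missing one column of [C] misses all of them and has its neighbours in [N], so two
   such columns would push its degree down to [r - 1]. *)
have C1 b b' : b \in C -> b' \in C -> b = b'.
  move=> bC bC'; apply/eqP; apply: contraT => nb.
  have := bC; rewrite !inE => /andP[xb /existsP[s /andP[sS ns]]].
  have nsx : s != x by apply: contraNneq ns => ->.
  have ns' : ~~ E s b' by apply: contra nsx => h; apply/eqP; apply: (hC b').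
  have : deg E s <= #|N :\ b :\ b'|.
    apply: subset_leq_card; apply/subsetP => c; rewrite !inE => sc.
    rewrite (hN s c) // andbT; apply/andP; split.
      by apply: contraNneq ns' => <-.
    by apply: contraNneq ns => <-.
  have := cardsD1 b N; have := cardsD1 b' (N :\ b).
  have xb' : E x b' by move: bC'; rewrite !inE => /andP[].
  have -> : b \in N by rewrite inE.
  have -> : b' \in N :\ b by rewrite !inE eq_sym nb.
  by move: cN (dS s sS); clear; lia.
have vC : v \notin C.
  by rewrite !inE negb_and; apply/orP; right; apply/existsPn => s; rewrite negb_and negbK;
      case: (boolP (s \in S)) => // /sv ->.
(* [c] is the column in [C] if there is one, and otherwise any column of [N] other than [v]. *)
have [c [cv cNn hc]] : exists c, [/\ c != v, c \in N & forall b, b \in N -> b != c -> b \notin C].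
  have [C0|[c cC]] := set_0Vmem C; last first.
    exists c; split.
    - by apply: contraNneq vC => <-.
    - by move: cC; rewrite inE => /andP[].
    - by move=> b bN; apply: contra => bC; apply/eqP; apply: C1.
  have : 0 < #|N :\ v| by have := cardsD1 v N; rewrite inE xv; lia.
  rewrite card_gt0 => /set0Pn[c]; rewrite !inE => /andP[h1 h2].
  by exists c; split => [//||b _ _]; [rewrite inE | rewrite C0 inE].
have fullN b s : b \in N -> b != c -> s \in S -> E s b.
  move=> bN bc sS; have := hc b bN bc; apply: contraNT => h.
  by rewrite inE bN; apply/existsP; exists s; rewrite sS.
pose xs1 := enum (~: S :\ u); pose xs2 := enum (S :\ x).
pose ys1 := enum (~: N); pose ys2 := enum (N :\ c :\ v).
have s1 : size xs1 = (m - r).-1.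
  by rewrite -cardE; have := cardsD1 u (~: S); rewrite inE uS; lia.
have s2 : size xs2 = r.-1.
  by rewrite -cardE; have := cardsD1 x S; rewrite xS; lia.
have s3 : size ys1 = (m - r).-1.
  by rewrite -cardE; have := cardsC N; rewrite cY; lia.
have s4 : size ys2 = r.-1.
  rewrite -cardE; have := cardsD1 c N; have := cardsD1 v (N :\ c).
  by rewrite cNn !inE eq_sym cv xv /=; lia.
have mr : r < m by have := cardsC N; rewrite cY; have := cardsD1 u (~: S); rewrite inE uS; lia.
have mX z : z \in u :: xs1 ++ x :: xs2.
  rewrite inE mem_cat inE !mem_enum !inE.
  by case: (z == u); case: (z == x); case: (z \in S).
have mY z : z \in ys1 ++ c :: rcons ys2 v.
  rewrite mem_cat inE mem_rcons inE !mem_enum !inE.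
  by case: (z == c); case: (z == v); case: (E x z).
apply: (@hpath_blocks2 _ _ E u x c v xs1 ys1 xs2 ys2) => //.
- by rewrite s1 s3.
- by rewrite s2 s4.
- by apply: uniq_full => //; rewrite cX /= size_cat /= s1 s2; lia.
- by apply: uniq_full => //; rewrite cY size_cat /= size_rcons s3 s4; lia.
- move=> a b ha _; apply: full; move: ha; rewrite inE mem_enum !inE.
  by case/orP => [/eqP-> //|/andP[]].
- by move: cNn; rewrite inE.
- move=> a b; rewrite !inE !mem_enum !inE => ha hb.
  have aS : a \in S by case/orP: ha => [/eqP-> //|/andP[]].
  case/orP: hb => [/eqP->|/and3P[h1 h2 h3]]; first exact: sv.
  by apply: fullN; rewrite ?inE.
Qed.

End Counting.

(** Subgraphs of [N] as seen after the deletion: [x] and [y] play the classes [X3] and [Y3], while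
    [u] and [v] are the only surviving vertices of [X2] and [Y2]. *)
Definition N_like (X Y : finType) (E : X -> Y -> bool) (u : X) (v : Y) : Prop :=
  exists x y, [/\ x != u, y != v, (forall y', E x y' -> y' = v \/ y' = y)
                & forall x', E x' y -> x' = u \/ x' = x].

Lemma N_like_transp (X Y : finType) (E : X -> Y -> bool) u v :
  N_like (transp E) v u -> N_like E u v.
Proof. by case=> y [x [h1 h2 h3 h4]]; exists x, y. Qed.

Lemma deg2P (X Y : finType) (E : X -> Y -> bool) x v : deg E x = 2 -> E x v ->
  exists z, [/\ z != v, E x z & forall b, E x b -> b = v \/ b = z].
Proof.
rewrite /deg (cardsD1 v) inE => + hv; rewrite hv => -[] /eqP/cards1P[z hz].
have : z \in [set y | E x y] :\ v by rewrite hz set11.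
rewrite !inE => /andP[h1 h2]; exists z; split => // b hb.
have [->|nb] := eqVneq b v; first by left.
by right; apply/eqP; rewrite -in_set1 -hz !inE nb.
Qed.

Lemma cards3 (T : finType) (a b c : T) : a != b -> a != c -> b != c ->
  #|[set a; b; c]| = 3.
Proof.
by move=> ab ac bc; rewrite setUC cardsU1 cards2 !inE ab ![c == _]eq_sym (negbTE ac) (negbTE bc).
Qed.

(** With [z] and [w] the second neighbours of [x] and [y], the path is [u ... z x v] if [y = v], and
    [u y w ... z x v] if [xy] is missing. Otherwise [xy] is an edge with [y] different from [v],
    which is [N_like]. *)
Lemma hpath_two_low (X Y : finType) m (E : X -> Y -> bool) u v x y :
  #|X| = m -> #|Y| = m -> ore_closed m E u v -> 2 < m ->
  x != u -> E x v -> deg E x = 2 -> deg (transp E) y = 2 ->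
  (forall a b, a != x -> b != y -> E a b) -> hpath E u v \/ N_like E u v.
Proof.
move=> cX cY hO m3 xu xv dx dy full.
(* Row [u] misses at most [y], so [d(u) + d(y) >= m + 1] and closedness applies. *)
have uy : E u y.
  apply: contraT => nuy; have [h1 h2] := hO _ _ nuy.
  suff hu : m.-1 <= deg E u by case: h2 => [|_ h]; [lia|rewrite h in nuy].
  have := cardsC1 y; rewrite cY => <-; apply: subset_leq_card; apply/subsetP => b.
  by rewrite !inE => hb; apply: full => //; rewrite eq_sym.
have [z [zv xz hx]] := deg2P dx xv.
have [w [wu yw hy]] := deg2P dy uy.
have [xy|nxy] := boolP (E x y).
  have [yv|yv] := eqVneq y v; last first.
    right; exists x, y; split => //.
      by move=> y' /hx[]; [left|right]; [|case: (hx y xy) => // h;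
          [rewrite h eqxx in yv|rewrite h]].
    by move=> x' /hy[]; [left|right]; [|case: (hy x xy) => // h;
        [rewrite h eqxx in xu|rewrite h]].
  left; pose xs := enum (~: [set u; x]); pose ys := enum (~: [set z; v]).
  have sx : size xs = m - 2 by rewrite -cardE; have := cardsC [set u; x];
      rewrite cards2 eq_sym xu cX; lia.
  have sy : size ys = m - 2 by rewrite -cardE; have := cardsC [set z; v];
      rewrite cards2 zv cY; lia.
  have mX a : a \in u :: xs ++ [:: x].
    by rewrite inE mem_cat mem_enum !inE; case: (a == u); case: (a == x).
  have mY a : a \in ys ++ z :: rcons [::] v.
    by rewrite mem_cat mem_enum !inE; case: (a == z); case: (a == v).
  apply: (@hpath_blocks2 _ _ E u x z v xs ys [::] [::]) => //.
  - by rewrite sx sy.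
  - by apply: uniq_full => //; rewrite cX /= size_cat /= sx; lia.
  - by apply: uniq_full => //; rewrite cY /= size_cat /= sy; lia.
  - move=> a b; rewrite !inE !mem_enum !inE => ha hb; apply: full.
      by case/orP: ha => [/eqP->|]; [rewrite eq_sym|rewrite negb_or => /andP[]].
    by case/orP: hb => [/eqP->|]; [rewrite yv|rewrite yv negb_or => /andP[]].
  - by move=> a b; rewrite !inE => /eqP-> /eqP->.
have wx : w != x by apply: contraNneq nxy => <-.
have yv : y != v by apply: contraNneq nxy => ->.
have yz : y != z by apply: contraNneq nxy => ->.
left; pose xs := enum (~: [set u; w; x]); pose ys := enum (~: [set y; z; v]).
have sx : size xs = m - 3.
  have := cardsC [set u; w; x]; rewrite cX cards3 // 1?eq_sym //.
  by move=> /(canRL (addKn 3)) <-; rewrite -cardE.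
have sy : size ys = m - 3.
  have := cardsC [set y; z; v]; rewrite cY cards3 //.
  by move=> /(canRL (addKn 3)) <-; rewrite -cardE.
have mX a : a \in u :: (w :: xs) ++ [:: x].
  by rewrite inE mem_cat !inE mem_enum !inE; case: (a == u); case: (a == w); case: (a == x).
have mY b : b \in rcons (y :: rcons ys z) v.
  by rewrite mem_rcons !inE mem_rcons !inE mem_enum !inE; case: (b == y); case: (b == z);
      case: (b == v).
apply: (@hpath_zig _ _ E u v ((w :: xs) ++ [:: x]) (y :: rcons ys z)) => //.
- by rewrite size_cat /= size_rcons sx sy addn1.
- by apply: uniq_full => //; rewrite cX /= size_cat /= sx; move: m3; clear; lia.
- by apply: uniq_full => //; rewrite cY size_rcons /= size_rcons sy; move: m3; clear; lia.
have -> : zig (u :: (w :: xs) ++ [:: x]) (rcons (y :: rcons ys z) v) =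
    inl u :: inr y :: (zig (w :: xs) (rcons ys z) ++ zig [:: x] [:: v]).
  by rewrite rcons_cons -cats1 -zig_cat // size_rcons /= sx sy.
suff h : path (bip_adj E) (inr y) (zig (w :: xs) (rcons ys z) ++ zig [:: x] [:: v]).
  by apply/andP; split.
rewrite cat_path zig_path => [|a [<-] //|a b]; last first.
  rewrite mem_rcons !inE !mem_enum !inE !negb_or => ha hb; apply: full.
    by case/orP: ha => [/eqP->|/andP[]].
  by case/orP: hb => [/eqP->|/andP[/andP[]]] //; rewrite eq_sym.
by rewrite last_zig /= ?sx ?sy // xz xv.
Qed.

(** * Closed graphs with few missing edges *)

Definition low_set (X Y : finType) (E : X -> Y -> bool) (t : nat) : {set X} :=
  [set x | deg E x <= t].

Definition dichotomy (X Y : finType) (t : nat) (E : X -> Y -> bool) (u : X) (v : Y) : Prop :=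
  [\/ hpath E u v, t <= #|low_set E t|, t <= #|low_set (transp E) t|
    | t = 2 /\ N_like E u v].

Lemma dichotomy_transp (X Y : finType) t (E : X -> Y -> bool) u v :
  dichotomy t (transp E) v u -> dichotomy t E u v.
Proof.
case=> [/hpath_transp h|h|h|[h1 /N_like_transp h2]].
- exact: Or41.
- exact: Or43.
- exact: Or42.
- exact: Or44.
Qed.

Section Core.
Variables (X Y : finType) (m t : nat) (E : X -> Y -> bool) (u : X) (v : Y).
Hypotheses (cX : #|X| = m) (cY : #|Y| = m) (t_gt0 : 0 < t).
Hypotheses (hO : ore_closed m E u v).
Hypotheses (dX : forall x, t <= deg E x) (dY : forall y, t <= deg (transp E) y).
Hypotheses (hmis : missing E < t.+1 * (m - t - 2)).

Let tm : t + 2 < m. Proof. by move: hmis; case: (ltnP (t + 2) m) => // h;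
    rewrite (_ : m - t - 2 = 0) ?muln0 //; lia. Qed.

Section TMinusOneLow.
Variables (S : {set X}) (x : X).
Hypotheses (cS : #|S| = t.-1) (xS : x \in S) (uS : u \notin S) (xv : E x v).
Hypothesis (dS : forall s, s \in S -> deg E s = t).

(** The degree [a] of [x'] decides. If [a <= t], then [x'] completes [S] to [t] low rows; if
    [a = t + 1], [hpath_low] applies to [x' |: S]; if [t + 2 <= a <= m - 2], too many edges are
    missing; and [a >= m - 1] forces [t = b = 2], the case of [hpath_two_low]. *)
Lemma dichotomy_off (x' : X) (y' : Y) : x' \notin S -> ~~ E x' y' ->
  (forall a b, a \notin S -> ~~ E a b ->
     deg E a + deg (transp E) b <= deg E x' + deg (transp E) y') ->
  dichotomy t E u v.
Proof.
move=> x'S nxy hmax.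
set a := deg E x' in hmax *; set b := deg (transp E) y' in hmax *.
have t2 : 1 < t by have : 0 < #|S| by [rewrite card_gt0; apply/set0Pn; exists x]; lia.
have [hab hab'] := hO nxy; rewrite -/a -/b in hab hab'.
have da := deg_codeg E x'; have db := deg_codeg (transp E) y'.
rewrite cY -/a in da; rewrite cX -/b in db.
have ca : 0 < codeg E x' by rewrite card_gt0; apply/set0Pn; exists y'; rewrite inE.
pose rest := \sum_(z in ~: S) codeg E z.
have hrest : t.-1 * (m - t) + rest <= missing E.
  by rewrite -cS; apply: missing_split => // s sS; rewrite dS.
(* These rows have degree at most [a] by maximality, and there are at least [a - t] of them because
   [a + b <= m + 1]. *)
pose S' := [set s in ~: S | ~~ E s y'].
have cS' : m - b <= t.-1 + #|S'|.
  have -> : m - b = codeg (transp E) y' by lia.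
  rewrite -cS /codeg -(cardsID S [set z | ~~ transp E y' z]) leq_add //; apply: subset_leq_card.
    by apply/subsetP => z; rewrite !inE => /andP[].
  by apply/subsetP => z; rewrite !inE.
have hS' s : s \in S' -> deg E s <= a.
  by rewrite !inE => /andP[h1 h2]; have := hmax _ _ h1 h2; rewrite -/b; lia.
have hrest' : #|S'| * (m - a) <= rest.
  rewrite /rest (bigID (mem S')) /= -[X in X <= _]addn0 leq_add //.
  rewrite (eq_bigl (mem S')); last by move=> z; rewrite !inE; case: (z \in S).
  rewrite -sum_nat_const; apply: leq_sum => s sS.
  by have := deg_codeg E s; have := hS' s sS; rewrite cY; lia.
have [at_|at_] := leqP a t.
  constructor 2; have cc : #|x' |: S| = t by rewrite cardsU1 x'S cS; lia.
  rewrite -{1}cc.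
  by apply: subset_leq_card; apply/subsetP => z; rewrite !inE => /orP[/eqP-> //|/dS ->].
have [at1|at1] := eqVneq a t.+1.
  constructor 1; pose S1 := x' |: S.
  have cS1 : #|S1| = t by rewrite cardsU1 x'S cS; lia.
  have hrest1 : rest = codeg E x' + \sum_(z in ~: S1) codeg E z.
    rewrite /rest (bigD1 x') ?inE //=; congr (_ + _).
    by apply: eq_bigl => z; rewrite !inE negb_or andbC.
  have full : forall c d, c \notin S1 -> E c d.
    move=> c d hc; apply: (complete_offX cX cY hO) hc; rewrite cS1.
    nia.
  apply: (@hpath_low _ _ m E cX cY u v S1 x') => //.
  - exact: setU11.
  - by rewrite cS1 -at1.
  - by move=> s _; rewrite cS1.
  (* If [x'] were [u], the [m - t] full rows would give [d(x') + d(y') = m + 1], and closedness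
     would make [u y'] an edge. *)
  rewrite inE negb_or inE uS andbT; apply/eqP => ux.
  have hb : b + a != m.+1.
    by apply/eqP => h; have [|_] := hab' _; [lia|rewrite ux; apply/negP].
  suff : #|~: S1| <= b by have := cardsC S1; rewrite cX cS1; lia.
  apply: subset_leq_card; apply/subsetP => z.
  by rewrite !inE => h; apply: full; rewrite !inE.
have [am|am] := leqP a (m - 2).
  (* For [t + 2 <= a <= m - 2] the product is at least [2 (m - t - 2)], whereas [rest] is below
     [2 (m - 2 t - 1)]. *)
  exfalso; have : (a - t) * (m - a) <= rest.
    by apply: leq_trans hrest'; rewrite leq_mul2r; apply/orP; right; lia.
  move: hrest hmis tm; clear -at_ at1 am t2.
  have [c ac] : exists c, a = t + 2 + c by exists (a - t - 2); move/eqP: at1; lia.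
  have [d md] : exists d, m = t + 2 + c + 2 + d by exists (m - (t + c + 4)); lia.
  rewrite ac md; nia.
have t2' : t = 2 by have := dY y'; rewrite -/b; lia.
have b2 : b = 2 by have := dY y'; rewrite -/b; lia.
have cS1 : S = [set x].
  by apply/esym/eqP; rewrite eqEcard sub1set xS cards1 cS t2'.
case: (@hpath_two_low _ _ m E u v x y' cX cY hO) => //.
- by lia.
- by apply: contraNneq uS => <-.
- by rewrite dS.
- move=> c d cx dy'; apply: (complete_off cX cY hO (S := S) (T := [set y']));
    rewrite ?cS1 ?inE // cards1 cards1.
  have : rest = \sum_(z in ~: [set x]) #|[set y in ~: [set y'] | ~~ E z y]| + #|S'|.
    have -> : #|S'| = \sum_(z in ~: [set x]) ~~ E z y'.
      rewrite -sum1_card [RHS](eq_bigr (fun z => if ~~ E z y' then 1 else 0));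
          last by move=> z _; case: (E z y').
      by rewrite -big_mkcondr; apply: eq_bigl => z; rewrite !inE cS1 inE.
    rewrite /rest cS1 -big_split; apply: eq_bigr => z _ /=.
    rewrite /codeg (cardsD1 y') inE addnC; congr (_ + _).
    by apply: eq_card => w; rewrite !inE.
  nia.
- by move=> h; constructor 1.
- by move=> h; constructor 4.
Qed.
End TMinusOneLow.

(** The set [S] of non-neighbours of [y] has [m - b] rows, of degree at most [a] by maximality, so
    at least [(m - b) (m - a)] edges are missing. If [a + b <= m], only [a = t] survives. If
    [a + b = m + 1], there remain [a = t + 1], settled by [hpath_low], and [a = t], where [S] has
    [t - 1] rows of degree [t]. *)
Lemma dichotomy_max (x : X) (y : Y) : ~~ E x y ->
  (forall a b, ~~ E a b -> deg E a + deg (transp E) b <= deg E x + deg (transp E) y) ->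
  deg E x <= deg (transp E) y -> dichotomy t E u v.
Proof.
move=> nxy hmax; set a := deg E x in hmax *; set b := deg (transp E) y in hmax * => ab.
have [hab hab'] := hO nxy; rewrite -/a -/b in hab hab'.
have ta : t <= a by exact: dX.
pose S := [set s | ~~ E s y].
have xS : x \in S by rewrite inE.
have cS : #|S| + b = m by have := deg_codeg (transp E) y; rewrite cX addnC.
have dSa s : s \in S -> deg E s <= a.
  by rewrite inE => /hmax; rewrite -/b; lia.
have hs := missing_split cX cY dSa.
have [s_m|s_m] := leqP (a + b) m.
  have [at_|at_] := leqP a t.
    constructor 2; apply: (@leq_trans #|S|); first by lia.
    by apply: subset_leq_card; apply/subsetP => s /dSa h; rewrite inE; lia.
  exfalso; have {hs} : a * (m - a) <= missing E.
    apply: leq_trans (leq_trans (leq_addr _ _) hs); rewrite leq_mul2r; apply/orP; right; lia.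
  move: hmis tm; clear -at_ ab s_m.
  have [c ac] : exists c, a = t + 1 + c by exists (a - t - 1); lia.
  have [d md] : exists d, m = t + 1 + c + (t + 1 + c) + d by exists (m - (a + a)); lia.
  rewrite ac md; nia.
have s_m' : a + b = m.+1 by lia.
have [xv uy] := hab' s_m'.
have cS' : #|S| = a.-1 by lia.
have uS : u \notin S by rewrite inE uy.
have [at_|at_] := leqP t.+2 a.
  (* For [t + 2 <= a <= (m + 1) / 2] the product [(a - 1) (m - a)] is smallest at [a = t + 2], where
     it equals the bound [(t + 1) (m - t - 2)] of [hmis]. *)
  exfalso; have {hs} : a.-1 * (m - a) <= missing E.
    by apply: leq_trans (leq_trans (leq_addr _ _) hs); rewrite leq_mul2r; apply/orP; right; lia.
  move: hmis tm; clear -at_ ab s_m'.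
  have [c ac] : exists c, a = t + 2 + c by exists (a - t - 2); lia.
  have [d md] : exists d, m.+1 = t + 2 + c + (t + 2 + c) + d by exists (m.+1 - (a + a)); lia.
  have {}md : m = t + 1 + c + (t + 2 + c) + d by lia.
  rewrite ac md; nia.
have [at1|at1] := eqVneq a t.+1.
  constructor 1; apply: (hpath_low cX cY hO xS) => //.
  - by rewrite cS'; lia.
  - by move=> s _; rewrite cS' at1.
  by move=> c d hc; apply: (complete_offX cX cY hO) hc; rewrite cS'; nia.
have {at_ at1 ta} ate : a = t by lia.
have dS s : s \in S -> deg E s = t by move=> /dSa; have := dX s; lia.
rewrite ate in cS'.
have [/existsP[[x1 y1] /andP[/= h1 h2]]|hfull] :=
    boolP [exists p : X * Y, (p.1 \notin S) && ~~ E p.1 p.2].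
  pose Pn (p : X * Y) := (p.1 \notin S) && ~~ E p.1 p.2.
  have P1 : Pn (x1, y1) by rewrite /Pn h1.
  case: (@arg_maxnP _ (x1, y1) Pn (fun p => deg E p.1 + deg (transp E) p.2) P1) => -[x' y']
      /andP[/= h1' h2'] hm.
  apply: (@dichotomy_off S x cS' xS uS xv dS x' y') => // c d hc hcd.
  by apply: (hm (c, d)); rewrite /Pn hc.
constructor 1; apply: (hpath_low cX cY hO xS) => //.
- by rewrite cS' -/a ate; lia.
- by move=> s /dS ->; rewrite cS'; lia.
move=> c d hc; move/existsPn: hfull => /(_ (c, d)) /=.
by rewrite hc negbK.
Qed.
End Core.

Lemma missing_transp (X Y : finType) (E : X -> Y -> bool) :
  missing (transp E) = missing E.
Proof.
have h (A B : finType) (F : A -> B -> bool) : missing F = \sum_a \sum_b ~~ F a b.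
  by apply: eq_bigr => a _; rewrite /codeg cardsE -sum1_card big_mkcond /=;
      apply: eq_bigr => b _; rewrite unfold_in; case: (F a b).
by rewrite !h exchange_big.
Qed.

Lemma hpath_complete (X Y : finType) m (E : X -> Y -> bool) u v :
  #|X| = m -> #|Y| = m -> 1 < m -> (forall x y, E x y) -> hpath E u v.
Proof.
move=> cX cY m1 full.
have [x xu] : exists x, x != u.
  have : 0 < #|[set~ u]| by rewrite cardsC1 cX; lia.
  by rewrite card_gt0 => /set0Pn[x]; rewrite !inE; exists x.
have [c cv] : exists c, c != v.
  have : 0 < #|[set~ v]| by rewrite cardsC1 cY; lia.
  by rewrite card_gt0 => /set0Pn[c]; rewrite !inE; exists c.
pose xs := enum (~: [set u; x]); pose ys := enum (~: [set c; v]).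
have sx : size xs = m - 2 by rewrite -cardE; have := cardsC [set u; x];
    rewrite cards2 eq_sym xu cX; lia.
have sy : size ys = m - 2 by rewrite -cardE; have := cardsC [set c; v]; rewrite cards2 cv cY; lia.
have mX a : a \in u :: xs ++ [:: x].
  by rewrite inE mem_cat mem_enum !inE; case: (a == u); case: (a == x).
have mY a : a \in ys ++ c :: rcons [::] v.
  by rewrite mem_cat mem_enum !inE; case: (a == c); case: (a == v).
apply: (@hpath_blocks2 _ _ E u x c v xs ys [::] [::]) => //.
- by rewrite sx sy.
- by apply: uniq_full => //; rewrite cX /= size_cat /= sx; lia.
- by apply: uniq_full => //; rewrite cY /= size_cat /= sy; lia.
Qed.

Lemma dichotomy_ore (X Y : finType) m t (E : X -> Y -> bool) u v :
  #|X| = m -> #|Y| = m -> 0 < t -> ore_closed m E u v ->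
  (forall x, t <= deg E x) -> (forall y, t <= deg (transp E) y) ->
  missing E < t.+1 * (m - t - 2) -> dichotomy t E u v.
Proof.
move=> cX cY t0 hO dX dY hmis.
have [/existsP[p0 h0]|hfull] := boolP [exists p : X * Y, ~~ E p.1 p.2]; last first.
  constructor 1; apply: (@hpath_complete _ _ m) => //.
    by move: hmis; case: (ltnP 1 m) => // h; rewrite (_ : m - t - 2 = 0) ?muln0 //; lia.
  by move=> x y; move/existsPn: hfull => /(_ (x, y)); rewrite negbK.
case: (@arg_maxnP _ p0 (fun p : X * Y => ~~ E p.1 p.2)
   (fun p => deg E p.1 + deg (transp E) p.2) h0) => -[x y] /= nxy hm.
have hm' a b : ~~ E a b -> deg E a + deg (transp E) b <= deg E x + deg (transp E) y.
  by move=> h; apply: (hm (a, b)).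
have [h|h] := leqP (deg E x) (deg (transp E) y).
  exact: (dichotomy_max cX cY t0 hO dX dY hmis nxy).
apply: dichotomy_transp.
apply: (@dichotomy_max _ _ m t (transp E) v u cY cX t0 (ore_closed_transp hO) dY dX _ y x nxy).
- by rewrite missing_transp.
- by move=> b a /hm' h'; rewrite addnC [X in _ <= X]addnC.
- exact: ltnW.
Qed.

(** * Passing to the closure *)

Lemma deg_mono (X Y : finType) (E F : X -> Y -> bool) x :
  (forall a b, E a b -> F a b) -> deg E x <= deg F x.
Proof. by move=> h; apply: subset_leq_card; apply/subsetP => y; rewrite !inE; apply: h. Qed.

(** Removing edges lowers degrees and preserves [N_like], so only the first outcome takes a
    hypothesis to come back from [F] to [E]. *)
Lemma dichotomy_sub (X Y : finType) t (E F : X -> Y -> bool) u v :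
  (forall a b, E a b -> F a b) -> (hpath F u v -> hpath E u v) ->
  dichotomy t F u v -> dichotomy t E u v.
Proof.
move=> EF hEF; case=> [/hEF h|h|h|[t2 [x [y [h1 h2 h3 h4]]]]].
- by constructor 1.
- constructor 2; apply: leq_trans h _; apply: subset_leq_card; apply/subsetP => x.
  by rewrite !inE; apply/leq_trans/deg_mono.
- constructor 3; apply: leq_trans h _; apply: subset_leq_card; apply/subsetP => x.
  by rewrite !inE; apply/leq_trans/deg_mono => a b; apply: EF.
- by constructor 4; split => //; exists x, y; split => // z /EF; auto.
Qed.

(** Bondy-Chvatal closure by induction on the number of missing edges. A [bad] pair may be added by
    [hpath_del], and the hypotheses persist as degrees grow and fewer edges are missing; without a
    [bad] pair the graph is [ore_closed]. *)
Lemma hpath_dichotomy (X Y : finType) m t (E : X -> Y -> bool) u v :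
  #|X| = m -> #|Y| = m -> 0 < t ->
  (forall x, t <= deg E x) -> (forall y, t <= deg (transp E) y) ->
  missing E < t.+1 * (m - t - 2) -> dichotomy t E u v.
Proof.
move=> cX cY t0.
have [N] := ubnP (missing E); elim: N E => // N IH E hN dX dY hmis.
pose bad (p : X * Y) := [&& ~~ E p.1 p.2, m < deg E p.1 + deg (transp E) p.2 &
  E p.1 v && E u p.2 ==> (m.+1 < deg E p.1 + deg (transp E) p.2)].
have [/existsP[[x y] /and3P[/= nxy b1 b2]]|hno] := boolP [exists p, bad p]; last first.
  apply: (@dichotomy_ore _ _ m) => // x y nxy.
  move/existsPn: hno => /(_ (x, y)); rewrite /bad /= nxy /=.
  case: (E x v); case: (E u y) => /=; rewrite ?andbT; lia.
pose F := add_edge E x y.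
have EF a b : E a b -> F a b by rewrite /F /add_edge => ->.
apply: (@dichotomy_sub _ _ _ E F) => //.
  apply: (@hpath_del _ _ _ _ _ _ _ m) => // xv uy.
  by move: b2; rewrite xv uy.
have hF : missing F < missing E.
  rewrite /missing (bigD1 x) // [X in _ < X](bigD1 x) //= -addSn leq_add //.
    apply: proper_card; apply/properP; split.
      by apply/subsetP => b; rewrite !inE; apply: contra => /EF.
    by exists y; rewrite !inE ?nxy // /F /add_edge !eqxx orbT.
  apply: leq_sum => a _; apply: subset_leq_card; apply/subsetP => b.
  by rewrite !inE; apply: contra => /EF.
apply: IH.
- by lia.
- by move=> a; apply: leq_trans (dX a) _; apply: deg_mono.
- by move=> b; apply: leq_trans (dY b) _; apply: deg_mono => b' a'; apply: EF.
- by lia.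
Qed.

(** * Relabelling, and deletion of a balanced set *)

Section Relabelling.
Variable n : nat.
Implicit Types (B : biadj n) (S : {set 'I_n}).

(** Relabellings are obtained below by listing the vertex classes in the desired order. *)
Lemma index_perm (s : seq 'I_n) : uniq s -> (forall i, i \in s) ->
  exists f : {perm 'I_n}, forall i, f i = index i s :> nat.
Proof.
move=> us ms.
have szs : size s = n by rewrite -[RHS](card_ord n) -(count_all predT us ms) count_predT.
have lt i : index i s < n by rewrite -{2}szs index_mem.
have inj : injective (fun i => Ordinal (lt i)).
  by move=> i j /(congr1 val) /= h; rewrite -(nth_index i (ms i)) h nth_index.
by exists (perm inj) => i; rewrite permE.
Qed.

Lemma split_perm S : exists f : {perm 'I_n}, forall i, (f i < n - #|S|) = (i \notin S).
Proof.
have [||f hf] := @index_perm (enum (~: S) ++ enum S).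
- rewrite cat_uniq !enum_uniq andbT /=; apply/hasPn => i.
  by rewrite !mem_enum inE negbK.
- by move=> i; rewrite mem_cat !mem_enum inE orNb.
exists f => i; rewrite hf index_cat mem_enum inE.
have c : #|~: S| = n - #|S| by have := cardsC S; rewrite card_ord; lia.
case: (boolP (i \in S)) => iS /=.
  by apply/negbTE; rewrite -leqNgt -cardE c leq_addr.
by rewrite -c cardE index_mem mem_enum inE.
Qed.

(** Listing the other indices first, then [S], then [x] matches the three classes of [Nclass]. *)
Lemma split_perm3 S x : x \notin S ->
  exists f : {perm 'I_n}, forall i, ((f i < n - #|S|.+1) = (i \notin S) && (i != x)) /\
    ((f i < n - 1) = (i != x)).
Proof.
move=> xS.
have cxS : #|x |: S| = #|S|.+1 by rewrite cardsU1 xS.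
have [||f hf] := @index_perm (enum (~: (x |: S)) ++ rcons (enum S) x).
- rewrite cat_uniq rcons_uniq !enum_uniq mem_enum xS !andbT /=; apply/hasPn => i.
  by rewrite mem_rcons inE !mem_enum !inE negbK.
- by move=> i; rewrite mem_cat mem_rcons inE !mem_enum !inE orNb.
have c : #|~: (x |: S)| = n - #|S|.+1 by have := cardsC (x |: S); rewrite cxS card_ord; lia.
have hn : #|S|.+1 <= n by have := cardsC (x |: S); rewrite cxS card_ord; lia.
exists f => i; rewrite hf index_cat mem_enum !inE -[size (enum _)]cardE c.
have [->|ix] := eqVneq i x.
  have e1 b c' : b - c'.+1 + c' < b - c'.+1 = false by apply/negbTE; lia.
  have e2 b c' : c' < b -> b - c'.+1 + c' < b - 1 = false by move=> h; apply/negbTE; lia.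
  by rewrite andbF /= -cats1 index_cat mem_enum (negbTE xS) /= eqxx -cardE addn0 e1 e2.
case: (boolP (i \in S)) => iS /=.
  have : index i (rcons (enum S) x) < #|S|.
    by rewrite -cats1 index_cat mem_enum iS cardE index_mem mem_enum.
  have e3 b c' d : c' < b -> d < c' -> (b - c'.+1 + d < b - c'.+1 = false) /\ (b - c'.+1 + d
      < b - 1).
    by move=> h1 h2; split; [apply/negbTE|]; lia.
  exact: e3.
have : index i (enum (~: (x |: S))) < n - #|S|.+1.
  by rewrite -c cardE index_mem mem_enum !inE negb_or ix.
have e4 b c' d : d < b - c'.+1 -> (d < b - c'.+1) /\ (d < b - 1) by move=> h; lia.
exact: e4.
Qed.

Lemma giso_perm B B' (f g : {perm 'I_n}) : (forall i j, B i j = B' (f i) (g j)) -> giso B B'.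
Proof.
move=> h; pose F (z : bvert n) : bvert n := match z with inl i => inl (f i) | inr j => inr (g
    j) end.
have Finj : injective F by case=> a; case=> b //= [] /perm_inj ->.
by exists (perm Finj) => -[a|a] [b|b]; rewrite !permE /= ?h.
Qed.

Lemma giso_perm_swap B B' (f g : {perm 'I_n}) : (forall i j, B i j = B' (g j) (f i)) -> giso B B'.
Proof.
move=> h; pose F (z : bvert n) : bvert n := match z with inl i => inr (f i) | inr j => inl (g
    j) end.
have Finj : injective F by case=> a; case=> b //= [] /perm_inj ->.
by exists (perm Finj) => -[a|a] [b|b]; rewrite !permE /= ?h.
Qed.

(** In [Mgraph] the vertices of low degree form [Y2], so low rows call for an exchange of the two
    sides. *)
Lemma giso_Mgraph_rows B S (N : {set 'I_n}) :
  (forall i j, B i j = (i \notin S) || (j \in N)) -> giso B (Mgraph n (n - #|N|) #|S|).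
Proof.
move=> h; have [f hf] := split_perm S; have [g hg] := split_perm N.
by apply: (@giso_perm_swap _ _ f g) => i j; rewrite /Mgraph hf leqNgt hg negbK.
Qed.

Lemma giso_Mgraph_cols B S (N : {set 'I_n}) :
  (forall i j, B i j = (j \notin S) || (i \in N)) -> giso B (Mgraph n (n - #|N|) #|S|).
Proof.
move=> h; have [f hf] := split_perm S; have [g hg] := split_perm N.
by apply: (@giso_perm _ _ g f) => i j; rewrite /Mgraph hf leqNgt hg negbK.
Qed.

End Relabelling.

Lemma subset_of_card (T : finType) (A : {set T}) t : t <= #|A| ->
  exists2 S : {set T}, S \subset A & #|S| = t.
Proof.
move=> h; exists [set x in take t (enum A)].
  by apply/subsetP => x; rewrite inE => /mem_take; rewrite mem_enum.
rewrite cardsE; have /card_uniqP -> : uniq (take t (enum A)) by rewrite take_uniq ?enum_uniq.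
by rewrite size_takel // -cardE.
Qed.

(** * Deleting a balanced set of [2p] vertices *)

Section Deletion.
Variables (n p k : nat) (B : biadj n) (W : {set bvert n}).
Hypotheses (Wbal : #|W :&: Xpart n| = #|W :&: Ypart n|) (cW : #|W| = 2 * p).
Hypotheses (hk : min_deg_ge B k) (pk : p < k).

Let WX : {set 'I_n} := [set i | inl i \in W].
Let WY : {set 'I_n} := [set j | inr j \in W].

Let cWX : #|WX| = #|W :&: Xpart n|.
Proof.
rewrite -(card_imset _ (@inl_inj 'I_n 'I_n)); apply: eq_card => z.
rewrite !inE; apply/imsetP/andP => [[i]|[]].
  by rewrite inE => h ->.
by case: z => // i h _; exists i; rewrite ?inE.
Qed.

Let cWY : #|WY| = #|W :&: Ypart n|.
Proof.
rewrite -(card_imset _ (@inr_inj 'I_n 'I_n)); apply: eq_card => z.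
rewrite !inE; apply/imsetP/andP => [[i]|[]].
  by rewrite inE => h ->.
by case: z => // i h _; exists i; rewrite ?inE.
Qed.

Let cXY : #|WX| = p /\ #|WY| = p.
Proof.
have : #|W :&: Xpart n| + #|W :&: Ypart n| = 2 * p.
  rewrite -cW -(cardsID (Xpart n) W); congr (_ + _); apply: eq_card => z.
  by rewrite !inE andbC; case: z.
by rewrite cWX cWY; lia.
Qed.

Let X : finType := {i : 'I_n | i \in ~: WX}.
Let Y : finType := {j : 'I_n | j \in ~: WY}.
Let E : X -> Y -> bool := fun x y => B (val x) (val y).

Let cX : #|X| = n - p.
Proof.
rewrite card_sig; have := cardsC WX; rewrite card_ord cXY.1 => /(canRL (addKn p)) <-.
by apply: eq_card => i; rewrite !inE.
Qed.

Let cY : #|Y| = n - p.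
Proof.
rewrite card_sig; have := cardsC WY; rewrite card_ord cXY.2 => /(canRL (addKn p)) <-.
by apply: eq_card => i; rewrite !inE.
Qed.

Lemma card_val (S : {set 'I_n}) (P : pred 'I_n) :
  #|[set z : {i | i \in ~: S} | P (val z)]| = #|[set i | P i] :\: S|.
Proof.
rewrite -(card_imset _ val_inj); apply: eq_card => i.
rewrite !inE; apply/imsetP/andP => [[z]|[h1 h2]].
  by rewrite inE => h ->; split => //; have := valP z; rewrite inE.
have iS : i \in ~: S by rewrite inE.
by exists (exist _ i iS); rewrite ?inE.
Qed.

Let degX (x : X) : deg B (val x) <= deg E x + p.
Proof.
rewrite /deg (@card_val WY (B (val x))) -(cardsID WY [set y | B (val x) y]) addnC leq_add2l.
by rewrite -cXY.2; apply: subset_leq_card; apply/subsetP => j; rewrite inE => /andP[].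
Qed.

Let degY (y : Y) : deg (transp B) (val y) <= deg (transp E) y + p.
Proof.
rewrite /deg (@card_val WX (transp B (val y))) -(cardsID WX [set x | transp B (val y) x])
    addnC leq_add2l.
by rewrite -cXY.1; apply: subset_leq_card; apply/subsetP => j; rewrite inE => /andP[].
Qed.

Lemma min_deg_row i : k <= deg B i.
Proof. by rewrite -(card_adj_inl B i) -cardsE; apply: (hk (inl i)). Qed.

Lemma min_deg_col j : k <= deg (transp B) j.
Proof. by rewrite -(card_adj_inr B j) -cardsE; apply: (hk (inr j)). Qed.

Let misE : missing E <= missing B.
Proof.
apply: leq_trans (_ : \sum_(x : X) codeg B (val x) <= _).
  apply: leq_sum => x _; rewrite /codeg (@card_val WY (fun j => ~~ B (val x) j)).
  exact: subset_leq_card (subsetDl _ _).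
rewrite -(big_sub (mem (~: WX)) (codeg B)) /missing [X in _ <= X](bigID (mem (~: WX))) /=.
exact: leq_addr.
Qed.

(** [W] takes [p] vertices from each side, so this is [hpath_dichotomy] with [m = n - p] and
    [t = k - p]; a degree at most [k - p] after the deletion was at most [k] before. In the last
    outcome [U] and [V] consist of the deleted vertices together with [u] and [v]. *)
Lemma ham_path_dichotomy (u v : 'I_n) : inl u \notin W -> inr v \notin W ->
  missing B < (k - p).+1 * (n - p - (k - p) - 2) ->
  [\/ ham_path B (~: W) (inl u) (inr v),
      k - p <= #|[set i | deg B i <= k]|,
      k - p <= #|[set j | deg (transp B) j <= k]|
    | k - p = 2 /\ exists (x y : 'I_n) (U V : {set 'I_n}),
        [/\ #|U| = p.+1, #|V| = p.+1, x \notin U /\ y \notin V,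
          (forall j, B x j -> j \in V \/ j = y)
        & (forall i, B i y -> i \in U \/ i = x)]].
Proof.
move=> uW vW hmis.
have uX : u \in ~: WX by rewrite !inE.
have vY : v \in ~: WY by rewrite !inE.
have dX (x : X) : k - p <= deg E x by have := degX x; have := min_deg_row (val x); lia.
have dY (y : Y) : k - p <= deg (transp E) y by have := degY y; have := min_deg_col (val y); lia.
have hmis' : missing E < (k - p).+1 * (n - p - (k - p) - 2) by apply: leq_ltn_trans hmis.
have kp : 0 < k - p by lia.
case: (@hpath_dichotomy X Y _ _ E (exist _ u uX) (exist _ v vY) cX cY kp dX dY hmis').
- move=> [s [us ms ps ls]]; constructor 1.
  pose f (z : X + Y) : bvert n := match z with inl x => inl (val x) | inr y => inr (val y) end.
  have finj : injective f by case=> a; case=> b //= [] /val_inj ->.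
  exists (map f s); split.
  + by rewrite -[inl u]/(f (inl (exist _ u uX))) -map_cons map_inj_uniq.
  + move=> z; rewrite -[inl u]/(f (inl (exist _ u uX))) -map_cons.
    apply/mapP/idP => [[z' _ ->]|]; rewrite inE; last move=> zW.
      by case: z' => -[i hi] /=; move: hi; rewrite !inE.
    case: z zW => [i|j] h.
      have hi : i \in ~: WX by rewrite !inE.
      by exists (inl (exist _ i hi)).
    have hj : j \in ~: WY by rewrite !inE.
    by exists (inr (exist _ j hj)).
  + rewrite -[inl u]/(f (inl (exist _ u uX))) path_map.
    by apply: sub_path ps => -[a|a] [b|b].
  + by rewrite -[inl u]/(f (inl (exist _ u uX))) last_map ls.
- move=> h; constructor 2; apply: leq_trans h _.
  rewrite -(card_imset _ val_inj); apply: subset_leq_card; apply/subsetP => i /imsetP[x].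
  by rewrite !inE => h ->; have := degX x; lia.
- move=> h; constructor 3; apply: leq_trans h _.
  rewrite -(card_imset _ val_inj); apply: subset_leq_card; apply/subsetP => i /imsetP[x].
  by rewrite !inE => h ->; have := degY x; lia.
- case=> k2 [x [y [xu yv hx hy]]]; constructor 4; split => //.
  exists (val x), (val y), (u |: WX), (v |: WY); split.
  + by rewrite cardsU1 cXY.1; have := uX; rewrite inE => ->.
  + by rewrite cardsU1 cXY.2; have := vY; rewrite inE => ->.
  + by have := valP x; have := valP y; rewrite !inE !negb_or => -> ->; rewrite !andbT; split;
      [move: xu|move: yv]; rewrite -val_eqE.
  + move=> j Bxj; rewrite !inE; case: (boolP (j \in WY)) => [|jW];
      first by rewrite inE => ->; left; rewrite orbT.
    have jY : j \in ~: WY by rewrite inE.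
    by case: (hx (exist _ j jY) Bxj) => [/(congr1 val)|/(congr1 val)] /= ->; [left;
        rewrite eqxx|right].
  + move=> i Biy; rewrite !inE; case: (boolP (i \in WX)) => [|iW];
      first by rewrite inE => ->; left; rewrite orbT.
    have iX : i \in ~: WX by rewrite inE.
    by case: (hy (exist _ i iX) Biy) => [/(congr1 val)|/(congr1 val)] /= ->; [left;
        rewrite eqxx|right].
Qed.

End Deletion.

(** * Spectral radius *)

Local Open Scope ring_scope.

(* Satisfied, with [r] the absolute value of an eigenvalue, by the absolute
   values of the two halves of an eigenvector of the adjacency matrix. *)
Definition subeig (R : realType) (n : nat) (B : biadj n) (r : R) (a b : 'I_n -> R) : Prop :=
  [/\ (forall i, 0 <= a i), (forall j, 0 <= b j),
      (forall i, r * a i <= \sum_j (B i j)%:R * b j),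
      (forall j, r * b j <= \sum_i (B i j)%:R * a i)
    & 0 < \sum_i a i + \sum_j b j].

Lemma subeig_transp (R : realType) n (B : biadj n) (r : R) a b :
  subeig B r a b -> subeig (fun j i => B i j) r b a.
Proof. by case=> h1 h2 h3 h4 h5; split => //; rewrite addrC. Qed.

(** * Eigenvectors, edge counts, and attainment of the spectral radius *)

Section Spec.
Variables (R : realType) (n : nat) (B : biadj n).

Lemma eigenvalueE (x : R) : eigenvalue (adjmx R B) x <->
  exists a b : 'I_n -> R, [/\ (forall i, \sum_j (B i j)%:R * b j = x * a i),
    (forall j, \sum_i (B i j)%:R * a i = x * b j)
    & (exists i, a i != 0) \/ (exists j, b j != 0)].
Proof.
have mulE (w : 'rV[R]_(n + n)) : w *m adjmx R B =
   row_mx (\row_i \sum_j (B i j)%:R * w 0 (rshift n j)) (\row_j \sum_i (B i j)%:R * w 0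
       (lshift n i)).
  apply/rowP => k; rewrite mxE big_split_ord /= -(splitK k).
  case: (split k) => l /=; rewrite ?row_mxEl ?row_mxEr mxE.
    rewrite big1 ?add0r => [|i _]; last by rewrite /adjmx block_mxEul mxE mulr0.
    by apply: eq_bigr => j _; rewrite /adjmx block_mxEdl !mxE mulrC.
  rewrite addrC big1 ?add0r => [|i _]; last by rewrite /adjmx block_mxEdr mxE mulr0.
  by apply: eq_bigr => j _; rewrite /adjmx block_mxEur !mxE mulrC.
split.
  move/eigenvalueP => [w hw wn0].
  exists (fun i => w 0 (lshift n i)), (fun j => w 0 (rshift n j)); split.
  - move=> i; have /rowP/(_ (lshift n i)) := hw.
    by rewrite mulE row_mxEl !mxE.
  - move=> j; have /rowP/(_ (rshift n j)) := hw.
    by rewrite mulE row_mxEr !mxE.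
  - have /rV0Pn[k] := wn0; rewrite -(splitK k); case: (split k) => l /= h; [left|right];
      by exists l.
case=> a [b [h1 h2 h3]]; apply/eigenvalueP.
exists (row_mx (\row_i a i) (\row_j b j)).
  rewrite mulE scale_row_mx; congr row_mx; apply/rowP => i; rewrite !mxE.
    by rewrite -h1; apply: eq_bigr => j _; rewrite row_mxEr mxE.
  by rewrite -h2; apply: eq_bigr => j _; rewrite row_mxEl mxE.
apply/rV0Pn; case: h3 => -[l hl]; [exists (lshift n l)|exists (rshift n l)].
  by rewrite row_mxEl mxE.
by rewrite row_mxEr mxE.
Qed.

Lemma eigenvalue_subeig (x : R) : eigenvalue (adjmx R B) x ->
  exists a b, subeig B `|x| a b.
Proof.
move/eigenvalueE => [a [b [h1 h2 h3]]].
exists (fun i => `|a i|), (fun j => `|b j|); split => //.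
- move=> i; rewrite -normrM -h1; apply: le_trans (ler_norm_sum _ _ _) _.
  by apply: ler_sum => j _; rewrite normrM normr_nat.
- move=> j; rewrite -normrM -h2; apply: le_trans (ler_norm_sum _ _ _) _.
  by apply: ler_sum => i _; rewrite normrM normr_nat.
- case: h3 => -[l hl].
    by rewrite (bigD1 l) //= -addrA ltr_pwDl ?normr_gt0 // addr_ge0 ?sumr_ge0.
  by rewrite addrC (bigD1 l) //= -addrA ltr_pwDl ?normr_gt0 // addr_ge0 ?sumr_ge0.
Qed.

(** Lagrange's identity: the double sum of squares is twice the difference of the two sides. *)
Lemma cauchy_schwarz (I : finType) (c b : I -> R) :
  (\sum_i c i * b i) ^+ 2 <= (\sum_i c i ^+ 2) * (\sum_i b i ^+ 2).
Proof.
have h : 0 <= \sum_i \sum_j (c i * b j - c j * b i) ^+ 2.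
  by apply: sumr_ge0 => i _; apply: sumr_ge0 => j _; apply: sqr_ge0.
have e : \sum_i \sum_j (c i * b j - c j * b i) ^+ 2 =
   2 * ((\sum_i c i ^+ 2) * (\sum_i b i ^+ 2) - (\sum_i c i * b i) ^+ 2).
  have e1 : (\sum_i c i ^+ 2) * (\sum_i b i ^+ 2) = \sum_i \sum_j c i ^+ 2 * b j ^+ 2.
    by rewrite mulr_suml; apply: eq_bigr => i _; rewrite mulr_sumr.
  have e2 : (\sum_i c i ^+ 2) * (\sum_i b i ^+ 2) = \sum_i \sum_j c j ^+ 2 * b i ^+ 2.
    by rewrite e1 exchange_big.
  have e3 : (\sum_i c i * b i) ^+ 2 = \sum_i \sum_j (c i * b i) * (c j * b j).
    by rewrite expr2 mulr_suml; apply: eq_bigr => i _; rewrite mulr_sumr.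
  have -> : 2 * ((\sum_i c i ^+ 2) * (\sum_i b i ^+ 2) - (\sum_i c i * b i) ^+ 2) =
    (\sum_i c i ^+ 2) * (\sum_i b i ^+ 2) + (\sum_i c i ^+ 2) * (\sum_i b i ^+ 2)
    - 2 * (\sum_i c i * b i) ^+ 2 by ring.
  rewrite {1}e1 e2 e3 mulr_sumr -big_split -sumrB; apply: eq_bigr => i _ /=.
  by rewrite mulr_sumr -big_split -sumrB; apply: eq_bigr => j _ /=; ring.
lra.
Qed.

(** Cauchy-Schwarz in row [i] gives [r^2 a_i^2 <= d(i) C], hence [r^2 A <= e C]; the columns give
    [r^2 C <= e A]. After adding, [A + C > 0] cancels. *)
Lemma subeig_edges (r : R) a b : 0 <= r -> subeig B r a b ->
  r ^+ 2 <= (\sum_i \sum_j B i j)%:R.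
Proof.
move=> r0 [a0 b0 ha hb hs].
pose e : R := \sum_i \sum_j (B i j)%:R.
have -> : (\sum_i \sum_j B i j)%:R = e.
  by rewrite natr_sum; apply: eq_bigr => i _; rewrite natr_sum.
pose A := \sum_i a i ^+ 2; pose C := \sum_j b j ^+ 2.
have sqB i j : ((B i j)%:R : R) ^+ 2 = (B i j)%:R by case: (B i j); rewrite ?expr1n ?expr0n.
have h1 : r ^+ 2 * A <= e * C.
  rewrite /A mulr_sumr /e mulr_suml; apply: ler_sum => i _.
  rewrite -exprMn; apply: le_trans (_ : (\sum_j (B i j)%:R * b j) ^+ 2 <= _).
    by rewrite lerXn2r ?nnegrE ?mulr_ge0 ?sumr_ge0 // => j _; rewrite mulr_ge0.
  by apply: le_trans (cauchy_schwarz _ _) _; rewrite (eq_bigr (fun j => (B i j)%:R)).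
have h2 : r ^+ 2 * C <= e * A.
  rewrite /C mulr_sumr /e exchange_big mulr_suml; apply: ler_sum => j _.
  rewrite -exprMn; apply: le_trans (_ : (\sum_i (B i j)%:R * a i) ^+ 2 <= _).
    by rewrite lerXn2r ?nnegrE ?mulr_ge0 ?sumr_ge0 // => i _; rewrite mulr_ge0.
  by apply: le_trans (cauchy_schwarz _ _) _; rewrite (eq_bigr (fun i => (B i j)%:R)).
have AC : 0 < A + C.
  have A0 : 0 <= A by apply: sumr_ge0 => i _; apply: sqr_ge0.
  have C0 : 0 <= C by apply: sumr_ge0 => i _; apply: sqr_ge0.
  rewrite lt_def addr_ge0 // andbT; apply/eqP => h.
  have eA : A = 0 by lra.
  have eC : C = 0 by lra.
  have za i : a i = 0.
    have /eqP := eA; rewrite psumr_eq0; last by move=> k _; apply: sqr_ge0.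
    by move=> /allP/(_ i (mem_index_enum _)); rewrite sqrf_eq0 => /eqP.
  have zb i : b i = 0.
    have /eqP := eC; rewrite psumr_eq0; last by move=> k _; apply: sqr_ge0.
    by move=> /allP/(_ i (mem_index_enum _)); rewrite sqrf_eq0 => /eqP.
  by move: hs; rewrite !big1 // addr0 ltxx.
rewrite -(ler_pM2r AC); lra.
Qed.

(** A crude consequence of [x^2 <= e], used to see that the set of eigenvalues is bounded above. *)
Lemma eigenvalue_le (x : R) : eigenvalue (adjmx R B) x ->
  x <= (\sum_i \sum_j B i j)%:R + 1.
Proof.
move/eigenvalue_subeig => [a [b /(subeig_edges (normr_ge0 x))]].
set e := (_%:R); have e0 : 0 <= e by apply: ler0n.
move=> h; apply: le_trans (ler_norm x) _; nra.
Qed.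

Lemma spec_rad_ge (x : R) : eigenvalue (adjmx R B) x -> x <= spec_rad R n B.
Proof.
move=> h; apply: ub_le_sup => //.
by exists ((\sum_i \sum_j B i j)%:R + 1) => y; apply: eigenvalue_le.
Qed.

Lemma seq_gap (s : seq R) (M : R) : (forall x, x \in s -> x < M) ->
  exists2 e, 0 < e & forall x, x \in s -> x <= M - e.
Proof.
elim: s => [|y s IH] h; first by exists 1.
have [x hx|e e0 he] := IH; first by apply: h; rewrite inE hx orbT.
have hy : y < M by apply: h; rewrite mem_head.
exists (Num.min e (M - y)); first by rewrite lt_min e0 subr_gt0.
move=> x; rewrite inE => /orP[/eqP->|/he h1].
  by have : Num.min e (M - y) <= M - y by [rewrite ge_min lexx orbT]; lra.
by have : Num.min e (M - y) <= e by [rewrite ge_min lexx]; lra.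
Qed.

(** The eigenvalues are roots of the characteristic polynomial, hence finitely many; were the
    supremum not among them, they would all stay below it by a fixed gap. *)
Lemma spec_rad_eigenvalue : 0 < spec_rad R n B -> eigenvalue (adjmx R B) (spec_rad R n B).
Proof.
move=> hpos; set E := [set x : R | eigenvalue (adjmx R B) x]%classic.
have hE : has_sup E.
  (* [sup] is 0 by default on a set without supremum, which positivity excludes. *)
  by apply: contrapT => h; move: hpos; rewrite /spec_rad -/E sup_out // ltxx.
pose p := char_poly (adjmx R B).
have p0 : p != 0 by apply: monic_neq0; apply: char_poly_monic.
have rP x : eigenvalue (adjmx R B) x = (x \in rootsR p).
  by have := roots_on_rootsR p0; move/(_ x); rewrite /= eigenvalue_root_char -/p => ->.
apply: contraT => hn.
have [x hx|e e0 he] := @seq_gap (rootsR p) (spec_rad R n B).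
  rewrite lt_neqAle spec_rad_ge ?rP // andbT.
  by apply: contraNneq hn => <-; rewrite rP.
have [x Ex hx] := sup_adherent e0 hE.
have : x <= spec_rad R n B - e by apply: he; rewrite -rP.
by rewrite /spec_rad -/E; lra.
Qed.

End Spec.

(** * Spectral bound for graphs with [t] rows of degree [k] *)

Section LowRows.
Variables (R : realType) (n k t : nat) (B : biadj n) (S : {set 'I_n}).
Variables (r : R) (a b : 'I_n -> R).
Hypotheses (r_gt0 : 0 < r) (hsub : subeig B r a b) (cS : #|S| = t).
Hypothesis dS : forall i, i \in S -> #|[set j | B i j]| = k.

Local Notation be i j := ((B i j)%:R : R).
Let l := r ^+ 2.
Let Sg := \sum_j b j.
Let Yv i := \sum_j be i j * b j.
Let Q := \sum_(i in S) Yv i.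
Let a0 i : 0 <= a i. Proof. by case: hsub. Qed.
Let b0 j : 0 <= b j. Proof. by case: hsub. Qed.
Let be0 i j : 0 <= be i j. Proof. exact: ler0n. Qed.
Let Yv0 i : 0 <= Yv i. Proof. by apply: sumr_ge0 => j _; rewrite mulr_ge0. Qed.
Let Q0 : 0 <= Q. Proof. exact: sumr_ge0. Qed.
Let Yv_le i : Yv i <= Sg.
Proof. by apply: ler_sum => j _; case: (B i j); rewrite ?mul1r ?mul0r. Qed.

Let Sg_gt0 : 0 < Sg.
Proof.
rewrite lt_def sumr_ge0 // andbT; apply/eqP => h0.
have [_ _ ha _] := hsub; rewrite -/Sg h0 addr0 => hs.
suff za i : a i = 0 by move: hs; rewrite big1 ?ltxx.
apply/eqP; rewrite eq_le a0 andbT -(pmulr_rle0 _ r_gt0).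
by apply: le_trans (ha i) _; have := Yv_le i; rewrite h0.
Qed.

Let step j : l * b j <= \sum_i be i j * Yv i.
Proof.
have [_ _ ha hb _] := hsub.
rewrite /l expr2 -mulrA; apply: le_trans (_ : r * (\sum_i be i j * a i) <= _).
  by rewrite ler_pM2l.
rewrite mulr_sumr; apply: ler_sum => i _; by rewrite mulrCA ler_wpM2l.
Qed.

Let split j : \sum_i be i j * Yv i = \sum_(i in S) be i j * Yv i + \sum_(i in ~: S) be i j * Yv i.
Proof. by rewrite (bigID (mem S)) /=; congr (_ + _); apply: eq_bigl => i; rewrite inE. Qed.

Let cCS : \sum_(i in ~: S) Sg = (n%:R - t%:R) * Sg.
Proof.
rewrite sumr_const -cS -[in n%:R](card_ord n) -(cardsC S) natrD addrC addKr.
by rewrite mulr_natl.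
Qed.

Let rhs j := (n%:R - t%:R) * Sg + \sum_(i in S) be i j * Yv i.

(** Each of the [n - t] rows outside [S] is bounded by [Sg], as if it were joined to every
    column. *)
Let step2 j : l * b j <= rhs j.
Proof.
apply: le_trans (step j) _; rewrite split addrC /rhs lerD2r -cCS.
apply: ler_sum => i _; case: (B i j); rewrite ?mul1r ?mul0r ?Yv_le //.
exact: ltW.
Qed.

Let sum_be i : i \in S -> \sum_j be i j = k%:R.
Proof.
move=> /dS <-; rewrite -natr_sum -sum1_card; congr (_%:R).
by rewrite big_mkcond [RHS]big_mkcond /=; apply: eq_bigr => j _; rewrite inE; case: (B i j).
Qed.

Let sum_rhs : \sum_j rhs j = n%:R * (n%:R - t%:R) * Sg + k%:R * Q.
Proof.
rewrite big_split /= sumr_const card_ord -[(_ * Sg) *+ n]mulr_natl mulrA; congr (_ + _).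
rewrite exchange_big /= /Q mulr_sumr; apply: eq_bigr => i iS.
by rewrite -mulr_suml sum_be.
Qed.

Let eq1 : l * Sg <= n%:R * (n%:R - t%:R) * Sg + k%:R * Q.
Proof. by rewrite -sum_rhs /Sg mulr_sumr; apply: ler_sum => j _; apply: step2. Qed.

(** The number of common neighbours of two rows. *)
Let com i i' := \sum_j be i j * be i' j.

Let com_le i i' : i \in S -> com i i' <= k%:R.
Proof.
move=> iS; rewrite -(sum_be iS); apply: ler_sum => j _.
by case: (B i j); case: (B i' j); rewrite ?mul1r ?mul0r.
Qed.

Let sum_be_rhs i : i \in S ->
  \sum_j be i j * rhs j = k%:R * ((n%:R - t%:R) * Sg) + \sum_(i' in S) com i i' * Yv i'.
Proof.
move=> iS; rewrite (eq_bigr (fun j => be i j * ((n%:R - t%:R) * Sg) + \sum_(i' in S) be i j *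
    be i' j * Yv i')).
  rewrite big_split /= -mulr_suml sum_be //; congr (_ + _).
  by rewrite exchange_big /=; apply: eq_bigr => i' _; rewrite mulr_suml.
by move=> j _; rewrite mulrDr mulr_sumr; congr (_ + _); apply: eq_bigr => i' _; rewrite mulrA.
Qed.

Let lYv i : l * Yv i = \sum_j be i j * (l * b j).
Proof. by rewrite mulr_sumr; apply: eq_bigr => j _; rewrite mulrCA. Qed.

Let eq2 : l * Q <= t%:R * k%:R * (n%:R - t%:R) * Sg + t%:R * k%:R * Q.
Proof.
have -> : t%:R * k%:R * (n%:R - t%:R) * Sg + t%:R * k%:R * Q =
   \sum_(i in S) (k%:R * ((n%:R - t%:R) * Sg) + k%:R * Q).
  by rewrite sumr_const cS -[(_ + _) *+ t]mulr_natl; ring.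
rewrite /Q mulr_sumr; apply: ler_sum => i iS.
rewrite lYv; apply: le_trans (_ : \sum_j be i j * rhs j <= _).
  by apply: ler_sum => j _; rewrite ler_wpM2l ?step2.
rewrite sum_be_rhs // lerD2l mulr_sumr; apply: ler_sum => i' _.
by rewrite ler_wpM2r ?com_le.
Qed.

(** [eq1] is multiplied by [l - t k], [Q] is eliminated through [eq2], and [Sg > 0] cancels. *)
Lemma low_rows_le : t%:R * k%:R < l ->
  (l - n%:R * (n%:R - t%:R)) * (l - t%:R * k%:R) <= t%:R * k%:R ^+ 2 * (n%:R - t%:R).
Proof.
move=> hl; rewrite -(ler_pM2r Sg_gt0).
have h1 : (l - n%:R * (n%:R - t%:R)) * Sg <= k%:R * Q by have := eq1; lra.
have h2 : (l - t%:R * k%:R) * Q <= t%:R * k%:R * (n%:R - t%:R) * Sg by have := eq2; lra.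
have k0 : 0 <= k%:R :> R by [].
apply: le_trans (_ : (l - t%:R * k%:R) * (k%:R * Q) <= _).
  by rewrite mulrAC mulrC ler_pM2l ?subr_gt0.
rewrite mulrCA; apply: le_trans (ler_wpM2l k0 h2) _.
by rewrite le_eqVlt; apply/orP; left; apply/eqP; ring.
Qed.

(** Equality in the quadratic makes [eq1] and [eq2] tight, and with them every inequality summed to
    obtain them. Thus the rows off [S] are full, and any two rows of [S] have [k] common neighbours,
    so the same neighbourhood. *)
Lemma low_rows_eq : t%:R * k%:R < l -> (0 < k)%N -> (0 < t < n)%N ->
  t%:R * k%:R ^+ 2 * (n%:R - t%:R) <=
    (l - n%:R * (n%:R - t%:R)) * (l - t%:R * k%:R) ->
  exists2 N : {set 'I_n}, #|N| = k & forall i j, B i j = (i \notin S) || (j \in N).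
Proof.
move=> hl k_gt0 /andP[t_gt0 tn] hge.
have k0 : 0 < k%:R :> R by rewrite ltr0n.
have nt0 : 0 < n%:R - t%:R :> R by rewrite subr_gt0 ltr_nat.
have lt0 : 0 < l - t%:R * k%:R by rewrite subr_gt0.
have e1 : l * Sg = n%:R * (n%:R - t%:R) * Sg + k%:R * Q.
  apply/eqP; rewrite eq_le eq1 /=.
  have h2 : (l - t%:R * k%:R) * Q <= t%:R * k%:R * (n%:R - t%:R) * Sg by have := eq2; lra.
  rewrite -(ler_pM2l lt0).
  have h3 : k%:R * ((l - t%:R * k%:R) * Q) <= k%:R * (t%:R * k%:R * (n%:R - t%:R) * Sg).
    by rewrite ler_pM2l.
  have := ler_wpM2r (ltW Sg_gt0) hge.
  by lra.
have e2 : l * Q = t%:R * k%:R * (n%:R - t%:R) * Sg + t%:R * k%:R * Q.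
  apply/eqP; rewrite eq_le eq2 /=.
  have h1 : (l - n%:R * (n%:R - t%:R)) * Sg = k%:R * Q by lra.
  have h3 := ler_wpM2r (ltW Sg_gt0) hge.
  have h4 : (l - n%:R * (n%:R - t%:R)) * (l - t%:R * k%:R) * Sg =
    (l - t%:R * k%:R) * (k%:R * Q) by rewrite -h1; ring.
  by rewrite -(ler_pM2l k0); lra.
have be_rhs j : l * b j = rhs j.
  apply/eqP; rewrite -subr_eq0 -oppr_eq0 opprB.
  have : \sum_j (rhs j - l * b j) == 0 by rewrite sumrB sum_rhs -mulr_sumr -/Sg e1 subrr.
  rewrite psumr_eq0; last by move=> i _; rewrite subr_ge0.
  by move=> /allP/(_ j (mem_index_enum _)).
have b_gt0 j : 0 < b j.
  have l0 : 0 < l by rewrite exprn_gt0.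
  rewrite -(pmulr_rgt0 _ l0) be_rhs ltr_pwDl ?mulr_gt0 //.
  by apply: sumr_ge0 => i _; rewrite mulr_ge0.
have fullB i j : i \notin S -> B i j.
  (* A missing pair [i j] would leave all of [Sg > 0] as slack. *)
  move=> iS; have : \sum_(i in ~: S) (Sg - be i j * Yv i) <= 0.
    rewrite sumrB cCS; have := step j; rewrite be_rhs split /rhs; lra.
  have ge i' : 0 <= Sg - be i' j * Yv i'.
    by rewrite subr_ge0; case: (B i' j); rewrite ?mul1r ?mul0r ?Yv_le ?ltW.
  have iC : i \in ~: S by rewrite inE.
  rewrite (bigD1 i) //=; case: (B i j) => //; rewrite mul0r subr0.
  have : 0 <= \sum_(i0 in ~: S | i0 != i) (Sg - be i0 j * Yv i0) by apply: sumr_ge0.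
  have := Sg_gt0; lra.
have Yv_gt0 i : i \in S -> 0 < Yv i.
  move=> iS; have : (0 < #|[set j | B i j]|)%N by rewrite dS.
  rewrite card_gt0 => /set0Pn[j]; rewrite inE => Bij.
  rewrite /Yv (bigD1 j) //= Bij mul1r ltr_pwDl //.
  by apply: sumr_ge0 => j' _; rewrite mulr_ge0.
(* The slacks in [com <= k], weighted by the positive [Yv i'], sum to zero because [eq2] is
   tight. *)
have slack : \sum_(i in S) \sum_(i' in S) (k%:R - com i i') * Yv i' = 0.
  have : l * Q = \sum_(i in S) (k%:R * ((n%:R - t%:R) * Sg) + \sum_(i' in S) com i i' * Yv i').
    rewrite /Q mulr_sumr; apply: eq_bigr => i iS; rewrite lYv -sum_be_rhs //.
    by apply: eq_bigr => j _; rewrite be_rhs.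
  rewrite e2 big_split /= sumr_const cS => h.
  have -> : \sum_(i in S) \sum_(i' in S) (k%:R - com i i') * Yv i' =
     t%:R * k%:R * Q - \sum_(i in S) \sum_(i' in S) com i i' * Yv i'.
    have -> : t%:R * k%:R * Q = \sum_(i in S) \sum_(i' in S) k%:R * Yv i'.
      by rewrite sumr_const cS -mulr_sumr -[(_ * _) *+ t]mulr_natl mulrA.
    rewrite -sumrB; apply: eq_bigr => i _; rewrite -sumrB.
    by apply: eq_bigr => i' _; rewrite mulrBl.
  move: h; rewrite -[(_ * (_ * _)) *+ t]mulr_natl; lra.
have com_k i i' : i \in S -> i' \in S -> com i i' = k%:R.
  move=> iS i'S.
  have nn x y : x \in S -> y \in S -> 0 <= (k%:R - com x y) * Yv y.
    by move=> xS yS; rewrite mulr_ge0 // subr_ge0 com_le.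
  have : (k%:R - com i i') * Yv i' <= 0.
    have s1 : 0 <= \sum_(x in S | x != i) \sum_(y in S) (k%:R - com x y) * Yv y.
      by apply: sumr_ge0 => x /andP[xS _]; apply: sumr_ge0 => y; apply: nn.
    have s2 : 0 <= \sum_(y in S | y != i') (k%:R - com i y) * Yv y.
      by apply: sumr_ge0 => y /andP[yS _]; apply: nn.
    by move: slack; rewrite (bigD1 i) //= (bigD1 i') //=; lra.
  by rewrite pmulr_lle0 ?Yv_gt0 // subr_le0 => h; apply/eqP; rewrite eq_le h com_le.
have sub i i' j : i \in S -> i' \in S -> B i j -> B i' j.
  move=> iS i'S Bij; have := com_k i i' iS i'S; rewrite -(sum_be iS) => /eqP.
  rewrite eq_sym -subr_eq0 -sumrB psumr_eq0; last first.
    by move=> x _; case: (B i x); case: (B i' x); rewrite ?mul1r ?mul0r ?subr0 ?subrr.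
  move=> /allP/(_ j (mem_index_enum _)); rewrite Bij mul1r /=.
  by case: (B i' j) => //; rewrite subr0 oner_eq0.
have : (0 < #|S|)%N by rewrite cS.
rewrite card_gt0 => /set0Pn[i0 i0S].
exists [set j | B i0 j]; first exact: dS.
move=> i j; rewrite inE; case: (boolP (i \in S)) => iS /=; last exact: fullB.
by apply/idP/idP; apply: sub.
Qed.

End LowRows.

(** * Explicit eigenvectors of [M] and [N] *)

Lemma sum_step3 (R : realType) (n c1 c2 : nat) (p q s : R) : (c1 <= c2 <= n)%N ->
  \sum_(j < n) (if (j < c1)%N then p else if (j < c2)%N then q else s) =
    c1%:R * p + (c2 - c1)%:R * q + (n - c2)%:R * s.
Proof.
move=> /andP[h1 h2].
pose f j := if (j < c1)%N then p else if (j < c2)%N then q else s.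
rewrite -(big_mkord xpredT f) (@big_cat_nat _ _ _ c1) //=; last exact: leq_trans h2.
rewrite (@big_cat_nat _ _ _ c2 c1) //= addrA; congr (_ + _ + _).
- rewrite (eq_big_nat _ _ (F2 := fun _ => p)).
    by rewrite sumr_const_nat subn0 mulr_natl.
  by move=> i /andP[_ hi]; rewrite /f hi.
- rewrite (eq_big_nat _ _ (F2 := fun _ => q)).
    by rewrite sumr_const_nat mulr_natl.
  by move=> i /andP[hi hi']; rewrite /f hi' ltnNge hi.
- rewrite (eq_big_nat _ _ (F2 := fun _ => s)).
    by rewrite sumr_const_nat mulr_natl.
  by move=> i /andP[hi hi']; rewrite /f !ltnNge hi (leq_trans h1 hi).
Qed.

Lemma sum_step2 (R : realType) (n c : nat) (p q : R) : (c <= n)%N ->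
  \sum_(j < n) (if (j < c)%N then p else q) = c%:R * p + (n - c)%:R * q.
Proof.
move=> h; have := @sum_step3 R n c n p q q; rewrite h leqnn subnn mul0r addr0 => <- //.
by apply: eq_bigr => j _; rewrite ltn_ord.
Qed.

(** An explicit eigenvector bounds [rho(M)] from below, the direction in which the hypothesis on
    [rho(G)] is used. The equation for [mu] is the equality case of [low_rows_le]. *)
Lemma Mgraph_spec_rad (R : realType) (n k t : nat) :
  (0 < k <= n)%N -> (0 < t < n)%N ->
  exists mu : R, [/\ 0 < mu, n%:R * (n%:R - t%:R) < mu ^+ 2,
    (mu ^+ 2 - n%:R * (n%:R - t%:R)) * (mu ^+ 2 - t%:R * k%:R) =
       t%:R * k%:R ^+ 2 * (n%:R - t%:R)
    & mu <= spec_rad R n (Mgraph n (n - k) t)].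
Proof.
move=> /andP[k_gt0 kn] /andP[t_gt0 tn].
have k0 : 0 < k%:R :> R by rewrite ltr0n.
have t0 : 0 < t%:R :> R by rewrite ltr0n.
have n0 : 0 < n%:R :> R by rewrite ltr0n; lia.
have nt0 : 0 < n%:R - t%:R :> R by rewrite subr_gt0 ltr_nat.
pose A : R := n%:R * (n%:R - t%:R); pose C : R := t%:R * k%:R.
pose D : R := t%:R * k%:R ^+ 2 * (n%:R - t%:R).
have A0 : 0 < A by rewrite mulr_gt0.
have C0 : 0 < C by rewrite mulr_gt0.
have D0 : 0 < D by rewrite !mulr_gt0 ?exprn_gt0.
pose s := Num.sqrt ((A - C) ^+ 2 + 4 * D).
have s2 : s ^+ 2 = (A - C) ^+ 2 + 4 * D by rewrite sqr_sqrtr // addr_ge0 ?sqr_ge0 //; lra.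
have s0 : 0 <= s by apply: sqrtr_ge0.
(* [l] is the larger root of [(z - A) (z - C) = D], the quotient eigenvalue
   equation for the square of an eigenvalue. *)
pose l := (A + C + s) / 2.
have hl : (l - A) * (l - C) = D.
  have -> : (l - A) * (l - C) = (s ^+ 2 - (A - C) ^+ 2) / 4 by rewrite /l; field.
  by rewrite s2; field.
have lA : A < l by have : A - C < s by [nra]; rewrite /l; lra.
have lC : C < l by have : C - A < s by [nra]; rewrite /l; lra.
have l0 : 0 < l by lra.
pose mu := Num.sqrt l.
have mu0 : 0 < mu by rewrite sqrtr_gt0.
have mu2 : mu ^+ 2 = l by rewrite sqr_sqrtr // ltW.
exists mu; rewrite mu2; split => //.
apply: spec_rad_ge; apply/eigenvalueE.
(* The eigenvector is constant on [X1], [X2], [Y1], [Y2]; the equation at [X1] determines [y]. *)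
pose y := mu * (l - C) / (n%:R - t%:R).
exists (fun i => if (i < n - k)%N then l - C else l), (fun j => if (j < n - t)%N then y else
    k%:R * mu).
have ny : (n%:R - t%:R) * y = mu * (l - C) by rewrite /y mulrC divfK // gt_eqF.
have rt : (n - t)%:R = n%:R - t%:R :> R by rewrite natrB // ltnW.
have rk : (n - k)%:R = n%:R - k%:R :> R by rewrite natrB.
split.
- move=> i; rewrite /Mgraph; case: (ltnP i (n - k)) => hi.
    rewrite (eq_bigr (fun j : 'I_n => if (j < n - t)%N then y else 0)).
      by rewrite sum_step2 ?leq_subr // mulr0 addr0 rt ny.
    by move=> j _; case: ltnP; rewrite ?mul1r ?mul0r.
  rewrite (eq_bigr (fun j : 'I_n => if (j < n - t)%N then y else k%:R * mu)).
    rewrite sum_step2 ?leq_subr // subKn ?(ltnW tn) // rt ny /C; ring.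
  by move=> j _; rewrite orbT mul1r.
- move=> j; rewrite /Mgraph; case: (ltnP j (n - t)) => hj.
    rewrite (eq_bigr (fun i : 'I_n => if (i < n - k)%N then l - C else l)).
      rewrite sum_step2 ?leq_subr // subKn // rk.
      have -> : mu * y = l * (l - C) / (n%:R - t%:R) by rewrite /y -mu2; field; rewrite gt_eqF.
      apply/eqP; rewrite eq_sym; rewrite -subr_eq0; apply/eqP.
      (* The equation at [Y1] is the quadratic [hl] divided by [n - t]. *)
      have -> : l * (l - C) / (n%:R - t%:R) - ((n%:R - k%:R) * (l - C) + k%:R * l) =
        ((l - A) * (l - C) - D) / (n%:R - t%:R) by rewrite /A /C /D; field; rewrite gt_eqF.
      by rewrite hl subrr mul0r.
    by move=> i _; rewrite mul1r.
  rewrite (eq_bigr (fun i : 'I_n => if (i < n - k)%N then 0 else l)).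
    by rewrite sum_step2 ?leq_subr // mulr0 add0r subKn // -mu2; ring.
  by move=> i _; case: ltnP; rewrite ?mul1r ?mul0r.
- have n_gt0 : (0 < n)%N by exact: leq_ltn_trans tn.
  left; exists (Ordinal n_gt0) => /=.
  by case: ifP => _; rewrite gt_eqF ?subr_gt0.
Qed.

(* Constant on the classes X1, X2, X3 (and Y1, Y2, Y3); the entries solve the
   quotient eigenvalue equations as soon as x (x - 1) (x - n + 1) = (k - 1) (x - n + k). *)
Definition Nvec (R : realType) (n k : nat) (x : R) (i : 'I_n) : R :=
  if (i < n - k)%N then (k - 1)%:R
  else if (i < n - 1)%N then x - n%:R + k%:R else x * (x - n%:R + 1).

Lemma Ngraph_sym n q i j : Ngraph n q i j = Ngraph n q j i.
Proof. by rewrite /Ngraph andbC; congr (~~ _ && ~~ _); rewrite andbC. Qed.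

Lemma Ngraph_spec_rad (R : realType) (n k : nat) : (2 <= k)%N -> (k < n)%N ->
  exists x : R, [/\ n%:R - 1 < x, (forall i, 0 < @Nvec R n k x i),
    (forall i, \sum_j (Ngraph n (k - 2) i j)%:R * Nvec k x j = x * Nvec k x i)
    & x <= spec_rad R n (Ngraph n (k - 2))].
Proof.
move=> k2 kn.
have kR : 2 <= k%:R :> R by rewrite ler_nat.
have knR : k%:R + 1 <= n%:R :> R by rewrite natr1 ler_nat.
have k1 : (k - 1)%:R = k%:R - 1 :> R by rewrite natrB //; lia.
pose P : {poly R} := 'X * ('X - 1%:P) * ('X - (n%:R - 1)%:P) - (k%:R - 1) *: ('X - (n%:R -
    k%:R)%:P).
have PE z : P.[z] = z * (z - 1) * (z - (n%:R - 1)) - (k%:R - 1) * (z - (n%:R - k%:R)).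
  by rewrite /P !hornerE.
(* The endpoint values are [P(n - 1) = - (k - 1)^2 < 0] and [P(n) = n (n - 1) - k (k - 1) > 0]. *)
have [x /andP[x1 x2] /rootP] : exists2 x, n%:R - 1 <= x <= n%:R & root P x.
  apply: poly_ivt; first by lra.
  by rewrite !PE; apply/andP; split; nra.
rewrite PE => hx.
have {}x1 : n%:R - 1 < x.
  rewrite lt_neqAle x1 andbT; apply/eqP => h; rewrite -h in hx; nra.
have pos i : 0 < @Nvec R n k x i.
  rewrite /Nvec; case: ifP => _; first by rewrite k1; lra.
  by case: ifP => _; [lra | apply: mulr_gt0; lra].
have eig i : \sum_j (Ngraph n (k - 2) i j)%:R * Nvec k x j = x * Nvec k x i.
  have cls (j : 'I_n) : Nclass (k - 2) j = if (j < n - k)%N then 1%N else if (j < n - 1)%N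
      then 2%N else 3%N.
    by rewrite /Nclass (_ : (n - (k - 2) - 2 = n - k)%N) //; lia.
  have b12 : (n - k <= n - 1 <= n)%N by lia.
  have r1 : (n - k)%:R = n%:R - k%:R :> R by rewrite natrB // ltnW.
  have r2 : (n - 1 - (n - k))%:R = k%:R - 1 :> R.
    by rewrite (_ : (n - 1 - (n - k) = k - 1)%N) //; lia.
  have r3 : (n - (n - 1))%:R = 1 :> R by rewrite (_ : (n - (n - 1) = 1)%N) //; lia.
  rewrite /Ngraph cls; rewrite {2}/Nvec; case: (ltnP i (n - k)) => hi /=.
    rewrite (eq_bigr (fun j : 'I_n => if (j < n - k)%N then (k - 1)%:R else if (j < n - 1)%N
        then x - n%:R + k%:R else 0)).
      by rewrite sum_step3 // r1 r2 k1; ring.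
    move=> j _; rewrite cls /Nvec; case: ifP => _ /=; first by rewrite mul1r.
    by case: ifP => _ /=; rewrite ?mul1r ?mul0r.
  case: (ltnP i (n - 1)) => hi' /=.
    rewrite (eq_bigr (Nvec k x)); last by move=> j _; rewrite mul1r.
    by rewrite /Nvec sum_step3 // r1 r2 r3 k1; lra.
  rewrite (eq_bigr (fun j : 'I_n => if (j < n - k)%N then 0 else if (j < n - 1)%N then x -
      n%:R + k%:R else x * (x - n%:R + 1))).
    by rewrite sum_step3 // r1 r2 r3; lra.
  move=> j _; rewrite cls /Nvec; case: ifP => _ /=; first by rewrite mul0r.
  by case: ifP => _ /=; rewrite mul1r.
exists x; split => //.
apply: spec_rad_ge; apply/eigenvalueE; exists (Nvec k x), (Nvec k x); split => //.
  by move=> j; rewrite -eig; apply: eq_bigr => i _; rewrite Ngraph_sym.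
have n_gt0 : (0 < n)%N by lia.
by left; exists (Ordinal n_gt0); rewrite gt_eqF.
Qed.

(** A Perron-Frobenius comparison. Pairing the inequalities for [C] with the positive eigenvector
    [h] of [F] forces [(a, b)] to satisfy the eigenvalue equations of [F] for [r]. As [b] is
    positive, an edge of [F] absent from [C] would violate [r a_i <= sum_j C_ij b_j]. *)
Lemma sub_spec_eq (R : realType) (n : nat) (F C : biadj n) (x r : R) (h a b : 'I_n -> R) (c :
    'I_n) :
  0 < x -> x <= r -> (forall i j, F i j = F j i) -> (forall j, F c j) ->
  (forall i, 0 < h i) -> (forall i, \sum_j (F i j)%:R * h j = x * h i) ->
  (forall i j, C i j -> F i j) -> subeig C r a b -> forall i j, C i j = F i j.
Proof.
move=> x0 xr Fsym Fc h0 hF CF [a0 b0 ha hb hs].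
have r0 : 0 < r by lra.
have CFb i : \sum_j (C i j)%:R * b j <= \sum_j (F i j)%:R * b j.
  by apply: ler_sum => j _; rewrite ler_wpM2r // ler_nat; case: (boolP (C i j)) => // /CF ->.
have CFa j : \sum_i (C i j)%:R * a i <= \sum_i (F i j)%:R * a i.
  by apply: ler_sum => i _; rewrite ler_wpM2r // ler_nat; case: (boolP (C i j)) => // /CF ->.
pose PA := \sum_i h i * a i; pose PB := \sum_j h j * b j.
have sb : \sum_i h i * (\sum_j (F i j)%:R * b j) = x * PB.
  rewrite (eq_bigr (fun i => \sum_j (F i j)%:R * h i * b j)); last first.
    by move=> i _; rewrite mulr_sumr; apply: eq_bigr => j _; rewrite mulrCA mulrA.
  rewrite exchange_big mulr_sumr; apply: eq_bigr => j _ /=; rewrite -mulr_suml mulrA -hF.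
  by congr (_ * _); apply: eq_bigr => i _; rewrite Fsym.
have sa : \sum_j h j * (\sum_i (F i j)%:R * a i) = x * PA.
  rewrite (eq_bigr (fun j => \sum_i (F i j)%:R * h j * a i)); last first.
    by move=> i _; rewrite mulr_sumr; apply: eq_bigr => j _; rewrite mulrCA mulrA.
  by rewrite exchange_big mulr_sumr; apply: eq_bigr => i _ /=; rewrite -mulr_suml mulrA -hF.
have t1 i : 0 <= h i * (\sum_j (F i j)%:R * b j - r * a i).
  by rewrite mulr_ge0 ?(ltW (h0 _)) // subr_ge0; apply: le_trans (ha i) (CFb i).
have t2 j : 0 <= h j * (\sum_i (F i j)%:R * a i - r * b j).
  by rewrite mulr_ge0 ?(ltW (h0 _)) // subr_ge0; apply: le_trans (hb j) (CFa j).
have e1 : \sum_i h i * (\sum_j (F i j)%:R * b j - r * a i) = x * PB - r * PA.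
  rewrite -sb /PA mulr_sumr -sumrB; apply: eq_bigr => i _; ring.
have e2 : \sum_j h j * (\sum_i (F i j)%:R * a i - r * b j) = x * PA - r * PB.
  rewrite -sa /PB mulr_sumr -sumrB; apply: eq_bigr => i _; ring.
have g1 : 0 <= x * PB - r * PA by rewrite -e1; apply: sumr_ge0.
have g2 : 0 <= x * PA - r * PB by rewrite -e2; apply: sumr_ge0.
have PA0 : 0 <= PA by apply: sumr_ge0 => i _; rewrite mulr_ge0 ?(ltW (h0 _)).
have PB0 : 0 <= PB by apply: sumr_ge0 => i _; rewrite mulr_ge0 ?(ltW (h0 _)).
have z1 : x * PB - r * PA = 0 by nra.
have z2 : x * PA - r * PB = 0 by nra.
have Fb i : \sum_j (F i j)%:R * b j = r * a i.
  move: e1; rewrite z1 => /eqP; rewrite psumr_eq0 // => /allP/(_ i (mem_index_enum _)).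
  by rewrite /= mulf_eq0 gt_eqF //= subr_eq0 => /eqP.
have Fa j : \sum_i (F i j)%:R * a i = r * b j.
  move: e2; rewrite z2 => /eqP; rewrite psumr_eq0 // => /allP/(_ j (mem_index_enum _)).
  by rewrite /= mulf_eq0 gt_eqF //= subr_eq0 => /eqP.
(* A zero of [b] spreads through the full vertex [c]: first [a c = 0], then [b = 0], then
   [a = 0]. *)
have b_gt0 j0 : 0 < b j0.
  rewrite lt_def b0 andbT; apply/eqP => bj0.
  have /eqP := Fa j0; rewrite bj0 mulr0 psumr_eq0; last by move=> i _; rewrite mulr_ge0.
  move=> /allP/(_ c (mem_index_enum _)); rewrite Fc mul1r /= => /eqP ac.
  have /eqP := Fb c; rewrite ac mulr0 psumr_eq0; last by move=> i _; rewrite mulr_ge0.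
  move=> /allP hbj.
  have bz j : b j = 0 by have := hbj j (mem_index_enum _); rewrite Fc mul1r /= => /eqP.
  have az i : a i = 0.
    have := Fb i; rewrite big1 => [/esym/eqP|j _]; last by rewrite bz mulr0.
    by rewrite mulf_eq0 gt_eqF //= => /eqP.
  by move: hs; rewrite !big1 ?addr0 ?ltxx.
move=> i j; apply/idP/idP; first exact: CF.
move=> Fij; apply: contraT => nC.
have : \sum_j ((F i j)%:R - (C i j)%:R) * b j <= 0.
  have -> : \sum_j ((F i j)%:R - (C i j)%:R) * b j = \sum_j (F i j)%:R * b j - \sum_j (C i
      j)%:R * b j.
    by rewrite -sumrB; apply: eq_bigr => l _; rewrite mulrBl.
  by rewrite Fb subr_le0 ha.
rewrite (bigD1 j) //= Fij (negbTE nC) subr0 mul1r.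
have : 0 <= \sum_(l < n | l != j) ((F i l)%:R - (C i l)%:R) * b l.
  apply: sumr_ge0 => l _; rewrite mulr_ge0 // subr_ge0 ler_nat.
  by case: (boolP (C i l)) => // /CF ->.
by have := b_gt0 j; lra.
Qed.

(** * From the spectral condition to the theorem *)

Lemma edges_missing n (B : biadj n) :
  (\sum_i \sum_j B i j + missing B = n * n)%N.
Proof.
rewrite /missing -big_split /= (eq_bigr (fun _ => n)) ?sum_nat_const ?card_ord // => i _.
rewrite -[RHS](card_ord n) -(deg_codeg B i); congr (_ + _)%N.
by rewrite /deg cardsE -sum1_card [RHS]big_mkcond; apply: eq_bigr => j _; rewrite unfold_in;
    case: (B i j).
Qed.

Lemma missing_lt (R : realType) n c (B : biadj n) (r : R) a b :
  0 <= r -> subeig B r a b -> c%:R < r ^+ 2 -> (missing B + c < n * n)%N.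
Proof.
move=> r0 hs hc; have := lt_le_trans hc (subeig_edges r0 hs).
by rewrite ltr_nat -(edges_missing B); lia.
Qed.

(** Both factors of the quadratic are positive at [mu^2] and increase from there, so [mu <= r]
    yields the hypothesis of [low_rows_eq]. *)
Lemma low_rows_M (R : realType) n k t (B : biadj n) (r mu : R) a b :
  0 < mu -> mu <= r -> (0 < t <= k)%N -> (k + t <= n)%N ->
  n%:R * (n%:R - t%:R) < mu ^+ 2 ->
  (mu ^+ 2 - n%:R * (n%:R - t%:R)) * (mu ^+ 2 - t%:R * k%:R) =
       t%:R * k%:R ^+ 2 * (n%:R - t%:R) ->
  subeig B r a b -> (forall i, (k <= deg B i)%N) ->
  (t <= #|[set i | (deg B i <= k)%N]|)%N ->
  exists S N : {set 'I_n}, [/\ #|S| = t, #|N| = k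
    & forall i j, B i j = (i \notin S) || (j \in N)].
Proof.
move=> mu0 mur /andP[t0 tk] ktn hA hmu hs hdeg /subset_of_card[S Ssub cS].
have r0 : 0 < r by apply: lt_le_trans mur.
have dS i : i \in S -> #|[set j | B i j]| = k.
  move=> /(subsetP Ssub); rewrite inE => h; apply/eqP; rewrite eqn_leq h.
  exact: hdeg.
have murr : mu ^+ 2 <= r ^+ 2 by rewrite ler_sqr ?nnegrE // ltW.
have tkR : t%:R * k%:R <= n%:R * (n%:R - t%:R) :> R.
  by rewrite -natrB -?natrM ?ler_nat; nia.
have [||||N cN hN] := @low_rows_eq R n k t B S r a b r0 hs cS dS.
- by lra.
- by lia.
- by apply/andP; split; lia.
- by rewrite -hmu; apply: ler_pM; lra.
by exists S, N.
Qed.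

(** For [L = r^2 > (n - 1)^2] the first factor in [low_rows_le] is at least 1, so [(n - 1)^2 - 2 k <
    2 k^2 (n - 2) <= (n - 3) (n - 2)], which is absurd for [k <= n - 3]. *)
Lemma low_rows_N (R : realType) n k (B : biadj n) (r : R) a b :
  (2 <= k)%N -> (2 * k ^ 2 + 3 <= n)%N -> n%:R - 1 < r ->
  subeig B r a b -> (forall i, (k <= deg B i)%N) ->
  (2 <= #|[set i | (deg B i <= k)%N]|)%N -> False.
Proof.
move=> k2 hn nr hs hdeg /subset_of_card[S Ssub cS].
have dS i : i \in S -> #|[set j | B i j]| = k.
  move=> /(subsetP Ssub); rewrite inE => h; apply/eqP; rewrite eqn_leq h.
  exact: hdeg.
have kR : 2 <= k%:R :> R by rewrite ler_nat.
have nR : 2 * k%:R ^+ 2 + 3 <= n%:R :> R by rewrite -natrX -natrM -natrD ler_nat.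
have n1 : k%:R <= n%:R - 3 :> R by nra.
have r0 : 0 < r by lra.
have r2 : (n%:R - 1) ^+ 2 < r ^+ 2 by rewrite ltr_sqr ?nnegrE; lra.
have big : 2 * k%:R < (n%:R - 1) ^+ 2 :> R by nra.
have := @low_rows_le R n k 2 B S r a b r0 hs cS dS.
move: r2 big; set L := r ^+ 2 => r2 big h.
have {}h := h (lt_trans big r2).
have h1 : 1 <= L - n%:R * (n%:R - 2%:R) by lra.
have h2 : 0 < L - 2%:R * k%:R by lra.
have h3 : 2%:R * k%:R ^+ 2 * (n%:R - 2%:R) <= (n%:R - 3) * (n%:R - 2) by nra.
nra.
Qed.

(** Relabelling [x] and [y] as last, with [U] and [V] just before them, turns [B] into a subgraph
    [C] of [N]; then [sub_spec_eq] makes the inclusion an equality. *)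
Lemma sub_Ngraph_giso (R : realType) n k (B : biadj n) (r x0 : R) a b (x y : 'I_n) (U V :
    {set 'I_n}) :
  (2 <= k)%N -> (k < n)%N ->
  0 < x0 -> (forall i, 0 < @Nvec R n k x0 i) ->
  (forall i, \sum_j (Ngraph n (k - 2) i j)%:R * Nvec k x0 j = x0 * Nvec k x0 i) ->
  x0 <= r -> subeig B r a b ->
  #|U| = (k - 1)%N -> #|V| = (k - 1)%N -> x \notin U -> y \notin V ->
  (forall j, B x j -> j \in V \/ j = y) -> (forall i, B i y -> i \in U \/ i = x) ->
  giso B (Ngraph n (k - 2)).
Proof.
move=> k2 kn x00 hpos heig x0r hs cU cV xU yV hx hy.
have [f hf] := split_perm3 xU; have [g hg] := split_perm3 yV.
have ck : (k - 1).+1 = k by lia.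
rewrite cU ck in hf; rewrite cV ck in hg.
pose C : biadj n := fun i j => B (f^-1%g i) (g^-1%g j).
have cls (i : 'I_n) : Nclass (k - 2) i = if (i < n - k)%N then 1%N else if (i < n - 1)%N then
    2%N else 3%N.
  by rewrite /Nclass (_ : (n - (k - 2) - 2 = n - k)%N) //; lia.
have Csub i j : C i j -> Ngraph n (k - 2) i j.
  rewrite /C /Ngraph -{2 3}(permKV f i) -{2 3}(permKV g j) !cls.
  move: (f^-1%g i) (g^-1%g j) => i' j' Bij.
  rewrite (hf i').1 (hf i').2 (hg j').1 (hg j').2.
  have [jy|jy] := eqVneq j' y.
    rewrite jy in Bij *; have [iU|ix] := hy i' Bij.
      by rewrite iU andbF /=; case: (i' != x).
    by rewrite ix eqxx !andbF.
  have [ix|ix] := eqVneq i' x.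
    rewrite ix in Bij *; have [jV|jy'] := hx j' Bij; last by rewrite jy' eqxx in jy.
    by rewrite jV !andbF.
  by rewrite !andbT; case: (i' \in U); case: (j' \in V).
have Csubeig : subeig C r (fun i => a (f^-1%g i)) (fun j => b (g^-1%g j)).
  have [a0 b0 ha hb hsum] := hs; split => //.
  - move=> i; rewrite (reindex_inj (@perm_inj _ g)) /=.
    by under eq_bigr do rewrite /C permK; apply: ha.
  - move=> j; rewrite (reindex_inj (@perm_inj _ f)) /=.
    by under eq_bigr do rewrite /C permK; apply: hb.
  - rewrite (reindex_inj (@perm_inj _ f)) /= [X in _ < _ + X](reindex_inj (@perm_inj _ g)) /=.
    by under eq_bigr do rewrite permK; under [X in _ < _ + X]eq_bigr do rewrite permK.
(* Index [n - k] is the first of class 2, whose rows are joined to every column. *)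
have c_lt : (n - k < n)%N by lia.
have CE := @sub_spec_eq R n (Ngraph n (k - 2)) C x0 r (Nvec k x0) _ _ (Ordinal c_lt)
  x00 x0r (@Ngraph_sym n (k - 2)) _ hpos heig Csub Csubeig.
apply: (@giso_perm _ _ _ f g) => i j; rewrite -CE ?/C ?permK // => l.
rewrite /Ngraph !cls /= ltnn (_ : (n - k < n - 1)%N) //; lia.
Qed.

(** Common to both parts: [c < r^2 <= e(G)] leaves fewer than [n^2 - c] missing edges, within the
    bound of [ham_path_dichotomy] by [hcn]; the last three hypotheses exclude its exceptional
    outcomes. *)
Lemma min_deg_ham (R : realType) (p k n : nat) (B : biadj n) (r : R) a b c :
  (p < k)%N -> min_deg_ge B k -> 0 <= r -> subeig B r a b -> c%:R < r ^+ 2 ->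
  (n * n <= c + (k - p).+1 * (n - p - (k - p) - 2))%N ->
  ((k - p <= #|[set i | (deg B i <= k)%N]|)%N -> False) ->
  ((k - p <= #|[set j | (deg (transp B) j <= k)%N]|)%N -> False) ->
  ((k - p = 2)%N -> forall (x y : 'I_n) (U V : {set 'I_n}),
     #|U| = p.+1 -> #|V| = p.+1 -> x \notin U -> y \notin V ->
     (forall j, B x j -> j \in V \/ j = y) -> (forall i, B i y -> i \in U \/ i = x) -> False) ->
  ham_biconnected_2p B p.
Proof.
move=> pk hk r0 hs hc hcn noX noY noN W Wbal cW u v.
rewrite !inE => /andP[uW]; case: u uW => // u uW _ /andP[vW]; case: v vW => // v vW _.
have hm : (missing B < (k - p).+1 * (n - p - (k - p) - 2))%N.
  by have := missing_lt r0 hs hc; lia.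
have [//|/noX[]|/noY[]|[k2 [x [y [U [V [cU cV [xU yV] hx hy]]]]]]] :=
  ham_path_dichotomy Wbal cW hk pk uW vW hm.
by case: (noN k2 x y U V).
Qed.

Theorem theorem1p5 (R : realType) (p k n : nat) (B : biadj n) :
  (p.+1 <= k)%N -> min_deg_ge B k ->
  ((k = p + 2)%N -> (2 * k ^ 2 + 3 <= n)%N ->
     spec_rad R n (Ngraph n (k - 2)%N) <= spec_rad R n B ->
     ~ giso B (Ngraph n (k - 2)%N) -> ham_biconnected_2p B p) /\
  ((k <> p + 2)%N -> ((k + 2) * (k - p + 1) <= n)%N ->
     spec_rad R n (Mgraph n (n - k)%N (k - p)%N) <= spec_rad R n B ->
     ~ giso B (Mgraph n (n - k)%N (k - p)%N) -> ham_biconnected_2p B p).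
Proof.
move=> pk hk; have hrow := min_deg_row hk; have hcol := min_deg_col hk.
split=> hkp hn hrho hiso.
  have k2 : (2 <= k)%N by lia.
  have kn : (k < n)%N by nia.
  have [x0 [x0n hpos heig hx0]] := @Ngraph_spec_rad R n k k2 kn.
  have x0r := le_trans hx0 hrho.
  have n1 : 1 <= n%:R :> R by rewrite ler1n; lia.
  have x00 : 0 < x0 by move: x0n n1; clear; lra.
  have r0 : 0 < spec_rad R n B := lt_le_trans x00 x0r.
  have [a [b hs]] := eigenvalue_subeig (spec_rad_eigenvalue r0).
  rewrite gtr0_norm // in hs.
  clear hx0 hrho; move: (spec_rad R n B) x0r r0 hs => r x0r r0 hs.
  have kp2 : (k - p = 2)%N by lia.
  apply: (@min_deg_ham R p k n B _ a b ((n - 1) * (n - 1)) pk hk (ltW r0) hs).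
  - rewrite natrM natrB; last by lia.
    rewrite -expr2 ltr_sqr ?nnegrE; lra.
  (* The claim is [2 n - 1 <= 3 (n - k - 2)], that is [n >= 3 k + 5]; it follows from
     [n >= 2 k^2 + 3], with nothing to spare for [k = 2]. *)
  - by rewrite kp2; nia.
  - rewrite kp2; apply: (low_rows_N k2 hn _ hs hrow); lra.
  - rewrite kp2; apply: (low_rows_N k2 hn _ (subeig_transp hs) hcol); lra.
  - move=> _ x y U V cU cV xU yV hx hy; apply: hiso.
    apply: (sub_Ngraph_giso k2 kn x00 hpos heig x0r hs _ _ xU yV hx hy); lia.
have k0 : (0 < k <= n)%N by nia.
have t0 : (0 < k - p < n)%N by nia.
have [mu [mu0 muA hmu hmur]] := @Mgraph_spec_rad R n k (k - p) k0 t0.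
have mur := le_trans hmur hrho.
have r0 : 0 < spec_rad R n B := lt_le_trans mu0 mur.
have [a [b hs]] := eigenvalue_subeig (spec_rad_eigenvalue r0).
rewrite gtr0_norm // in hs.
clear hmur hrho; move: (spec_rad R n B) mur r0 hs => r mur r0 hs.
have t1 : (0 < k - p <= k)%N by lia.
have t2 : (k + (k - p) <= n)%N by nia.
apply: (@min_deg_ham R p k n B _ a b (n * (n - (k - p))) pk hk (ltW r0) hs).
- rewrite natrM natrB; last by lia.
  apply: lt_le_trans muA _; by rewrite ler_sqr ?nnegrE // ltW.
(* With [t = k - p], the claim [t n <= (t + 1) (n - k - 2)] is equivalent to the hypothesis
   [n >= (k + 2) (t + 1)]. *)
- by move: t0 t1 t2 hn pk; clear; nia.
- move=> h; have [S [N [cS cN hB]]] := low_rows_M mu0 mur t1 t2 muA hmu hs hrow h.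
  by apply: hiso; rewrite -cS -cN; apply: giso_Mgraph_rows.
- move=> h; have [S [N [cS cN hB]]] := low_rows_M mu0 mur t1 t2 muA hmu (subeig_transp hs) hcol h.
  by apply: hiso; rewrite -cS -cN; apply: giso_Mgraph_cols => i j; rewrite -hB.
- by lia.
Qed.
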